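(* Let $n\ge 9$ and let $G\in\mathscr{U}_{n,4}\setminus\{U_{n,4}\}$, i.e. $G$ is an $n$-vertex unicyclic graph with matching number $4$ that is not isomorphic to $U_{n,4}$. (i) If $9\le n\le 15$, then $\xi^d(G)\ge 6n^2+17n-147$, with equality if and only if $G\cong C_5(1^1,1^{n-7},1^1)$. (ii) If $n\ge 16$, then $\xi^d(G)\ge 6n^2+14n-100$, with equality if and only if $G\cong U_{n,4}'$.
   Context: All graphs are finite, simple and connected. For a graph $G$ and $v\in V_G$, $d(u,v)$ is the usual graph distance, $\varepsilon_G(v)=\max_{u\in V_G} d(u,v)$ is the eccentricity, and $D_G(v)=\sum_{u\in V_G} d(u,v)$. The eccentric distance sum is $\xi^d(G)=\sum_{v\in V_G}\varepsilon_G(v)D_G(v)$. A unicyclic graph is a connected graph with $|V_G|=|E_G|$. The matching number is the maximum number of pairwise independent edges. $\mathscr{U}_{n,m}$ is the set of unicyclic graphs with $n$ vertices and matching number $m$. $C_5(1^{k_1},1^{k_2},1^{k_3})$ is the graph obtained from the cycle $C_5=u_1u_2u_3u_4u_5u_1$ by attaching $k_i$ pendant vertices to $u_i$ for $i=1,2,3$. $U_{n,4}$ is the $n$-vertex graph obtained from a triangle $u_1u_2u_3u_1$ by attaching $n-7$ pendant vertices and two pendant paths of length $2$ (each by identifying one of its end vertices with $u_1$) to the single vertex $u_1$. $U_{n,4}'$ is the $n$-vertex graph obtained from a cycle $C_5=u_1u_2u_3u_4u_5u_1$ by attaching $n-7$ pendant vertices and one pendant path of length $2$ (identifying one of its end vertices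 with $u_2$) to the single vertex $u_2$. *)

(* Defs.v *)
From mathcomp Require Import all_boot.

Set Implicit Arguments.
Unset Strict Implicit.
Unset Printing Implicit Defensive.

Record sgraph := SGraph {
  vertex :> finType;
  adj : rel vertex;
  adj_sym : symmetric adj;
  adj_irr : irreflexive adj }.

Definition iso (G H : sgraph) : Prop :=
  exists2 f : G -> H, bijective f & {mono f : x y / adj x y}.

Section Invariants.

Variable G : sgraph.

Definition connected : Prop := forall x y : G, connect (@adj G) x y.

Definition edges : {set {set G}} :=
  [set [set p.1; p.2] | p : G * G & adj p.1 p.2].

Definition unicyclic : Prop := connected /\ #|G| = #|edges|.

Definition matching (M : {set {set G}}) : bool :=
  (M \subset edges) && trivIset M.

Definition matching_number : nat :=
  \max_(M : {set {set G}} | matching M) #|M|.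

Definition walk (k : nat) (x y : G) : bool :=
  [exists p : k.-tuple G, path (@adj G) x p && (last x p == y)].

(* The least length of a walk from x to y; it is below #|G| when y is
   reachable from x, and the junk value is #|G| otherwise. *)
Definition dist (x y : G) : nat := find (fun k => walk k x y) (iota 0 #|G|).

Definition ecc (v : G) : nat := \max_(u : G) dist u v.

Definition dist_sum (v : G) : nat := \sum_(u : G) dist u v.

Definition eds : nat := \sum_(v : G) ecc v * dist_sum v.

End Invariants.

Definition in_U (n m : nat) (G : sgraph) : Prop :=
  [/\ #|G| = n, unicyclic G & matching_number G = m].

Section Cycle.

(* The cycle on 'I_k.+3, so that its length is at least 3. *)
Variable k : nat.

Definition cycle_adj : rel 'I_k.+3 :=
  [rel i j | (j == ordS i) || (i == ordS j)].

Lemma cycle_adj_sym : symmetric cycle_adj.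
Proof. by move=> i j; rewrite /cycle_adj /= orbC. Qed.

Lemma cycle_adj_irr : irreflexive cycle_adj.
Proof.
move=> i; rewrite /cycle_adj /= orbb -val_eqE /=; apply/negbTE.
have := ltn_ord i; rewrite leq_eqVlt => /orP[/eqP[->]|lt_i].
  by rewrite modnn.
by rewrite modn_small // neq_ltn ltnSn.
Qed.

Definition cycle_graph : sgraph := SGraph cycle_adj_sym cycle_adj_irr.

End Cycle.

Section Pendants.

Variables (G : sgraph) (v : G) (k : nat).

Definition pendants_adj (x y : G + 'I_k) : bool :=
  match x, y with
  | inl a, inl b => adj a b
  | inl a, inr _ | inr _, inl a => a == v
  | inr _, inr _ => false
  end.

Lemma pendants_adj_sym : symmetric pendants_adj.
Proof. by move=> [a|i] [b|j] //=; apply: adj_sym. Qed.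

Lemma pendants_adj_irr : irreflexive pendants_adj.
Proof. by move=> [a|i] //=; apply: adj_irr. Qed.

(* k pendant vertices attached to v. *)
Definition pendants : sgraph := SGraph pendants_adj_sym pendants_adj_irr.

(* The new vertices inr 0, ..., inr k.-1 form a path in this order, and
   inr 0 is joined to v: a path of length k is identified with v at one end. *)
Definition pendant_path_adj (x y : G + 'I_k) : bool :=
  match x, y with
  | inl a, inl b => adj a b
  | inl a, inr i | inr i, inl a => (a == v) && (i == 0 :> nat)
  | inr i, inr j => (j == i.+1 :> nat) || (i == j.+1 :> nat)
  end.

Lemma pendant_path_adj_sym : symmetric pendant_path_adj.
Proof. by move=> [a|i] [b|j] //=; [apply: adj_sym | rewrite orbC]. Qed.

Lemma pendant_path_adj_irr : irreflexive pendant_path_adj.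
Proof.
by move=> [a|i] /=; [apply: adj_irr | apply/negbTE; rewrite orbb neq_ltn ltnSn].
Qed.

Definition pendant_path : sgraph :=
  SGraph pendant_path_adj_sym pendant_path_adj_irr.

End Pendants.

(* The vertices u_1, u_2, u_3, ... are numbered 0, 1, 2, ... below; each
   attachment sends an old vertex x to inl x. *)

Definition C5u (i : nat) : cycle_graph 2 := inord i.

Definition C5_1 (k1 k2 k3 : nat) : sgraph :=
  let G1 := pendants (C5u 0) k1 in
  let G2 := pendants (inl (C5u 1) : G1) k2 in
  pendants (inl (inl (C5u 2)) : G2) k3.

Definition U4 (n : nat) : sgraph :=
  let C3u1 : cycle_graph 0 := inord 0 in
  let G1 := pendants C3u1 (n - 7) in
  let G2 := pendant_path (inl C3u1 : G1) 2 in
  pendant_path (inl (inl C3u1) : G2) 2.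

Definition U4' (n : nat) : sgraph :=
  let G1 := pendants (C5u 1) (n - 7) in
  pendant_path (inl (C5u 1) : G1) 2.

(* Main.v *)
(* Let c be a vertex of eccentricity at most 2, A its neighbours and B the other
   vertices, with a = #|A| and b = #|B|. A breadth-first tree from c accounts for
   all edges but one, s-t. Two vertices hanging from different neighbours of c
   are joined through c by a shortest path unless the edge s-t links their
   branches. Writing S_XY for the sum of the distances between X and Y, and
   bounding the eccentricities below by 2 at c, 3 on A and 4 on B, we get
     eds G >= 5 (a + 2 b) + 2 b + 3 S_AA + 7 S_AB + 4 S_BB;
   each S_XY is estimated pairwise according to the position of s-t. A matching
   of size 4 forbids vertex covers of size 3, which excludes b <= 2 except in
   U_{n,4}, and the extremal graphs appear when s-t closes a 5-cycle through c:
   b = 3 gives U'_{n,4} and b = 4 gives C_5(1, n-7, 1). The eccentricities of s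
   and t can drop to 3 only in the latter configuration, where no vertex of B
   lies outside the branches of s and t.
   If all eccentricities are at least 3, every leaf has eccentricity at least 4,
   and counting leaves and 2-paths suffices. *)
Require Import Defs.
From mathcomp Require Import all_boot.
From mathcomp Require Import zify.

Set Implicit Arguments.
Unset Strict Implicit.
Unset Printing Implicit Defensive.

(** * Distances *)

(** The values [6n^2 + 17n - 147] and [6n^2 + 14n - 100] cross at n = 47/3, so for every n the
    smaller one is the bound to prove, and a graph strictly above either of them is settled. The
    case analysis can thus ignore the range of n and aim at the value that fits b: the surplus over
    the first is [9ab + 2b^2 - 30a - 39b] up to terms free of a, which grows with a for b >= 4 but
    decreases for b = 3, where the second value takes over.

    The eccentricities 3 on A and 4 on B need vertices of B in two branches that s-t does not link.
    So B is split by a predicate on branches that treats the branches of s and t alike, and vertex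
    covers show that both classes are inhabited. This is impossible only when s and t lie in B, in
    different branches that together contain all of B; there a finer count replaces the split, with
    weight 3 on s and t.

    Since n is arbitrary, the extremal graphs are recognized by the parents of seven vertices, all
    others being leaves at the hub. *)

Section Walks.

Variable G : sgraph.
Implicit Types (x y z : G) (k : nat).

Lemma walk0 x y : walk 0 x y = (x == y).
Proof.
apply/existsP/idP => [[p]|/eqP <-]; first by rewrite tuple0.
by exists [tuple]; rewrite /= eqxx.
Qed.

Lemma walkS k x y : walk k.+1 x y = [exists z, adj x z && walk k z y].
Proof.
apply/existsP/existsP => [[p]|[z /andP[xz /existsP[p zp]]]].
  rewrite (tuple_eta p) /= -andbA => /andP[xz zp]; exists (thead p).
  by rewrite xz; apply/existsP; exists (behead_tuple p).
by exists [tuple of z :: p]; rewrite /= xz.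
Qed.

Lemma dist_min k x y : walk k x y -> dist x y <= k.
Proof.
move=> wk; have [lt_k|le_k] := ltnP k #|G|; last first.
  by apply: leq_trans le_k; rewrite -[leqRHS](size_iota 0) find_size.
rewrite leqNgt; apply/negP => /(before_find 0).
by rewrite nth_iota // add0n wk.
Qed.

Lemma distxx x : dist x x = 0.
Proof. by apply/eqP; rewrite -leqn0 dist_min // walk0. Qed.

End Walks.

Lemma walk_iso (G H : sgraph) (f : G -> H) k x y :
  bijective f -> {mono f : x y / adj x y} -> walk k (f x) (f y) = walk k x y.
Proof.
move=> bij_f mono_f; have inj_f := bij_inj bij_f; case: bij_f => g fK gK.
elim: k x => [|k IHk] x; first by rewrite !walk0 inj_eq.
rewrite !walkS; apply/existsP/existsP => -[z]; last first.
  by move=> /andP[xz wz]; exists (f z); rewrite mono_f xz IHk.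
rewrite -(gK z) mono_f IHk => xz; by exists (g z).
Qed.

Lemma dist_iso (G H : sgraph) (f : G -> H) x y :
  bijective f -> {mono f : x y / adj x y} -> dist (f x) (f y) = dist x y.
Proof.
move=> bij_f mono_f; rewrite /dist (bij_eq_card bij_f).
by apply: eq_find => k; apply: walk_iso.
Qed.

Lemma eds_iso (G H : sgraph) : iso G H -> eds G = eds H.
Proof.
case=> f bij_f mono_f; rewrite /eds (reindex f) /=; last exact: onW_bij.
apply: eq_bigr => v _; rewrite /ecc /dist_sum.
rewrite [in RHS](reindex f) /=; last exact: onW_bij.
rewrite [X in _ = _ * X](reindex f) /=; last exact: onW_bij.
by congr (_ * _); apply: eq_bigr => u _; rewrite dist_iso.
Qed.

Section Distance.

Variable G : sgraph.
Hypothesis connG : connected G.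
Implicit Types (x y z : G) (k : nat).

(** A path without repetition has fewer than [#|G|] edges, so the search defining [dist] succeeds
    and the junk value does not occur. *)
Lemma walk_dist x y : walk (dist x y) x y.
Proof.
suff: has (fun k => walk k x y) (iota 0 #|G|).
  move=> has_w; have := nth_find 0 has_w; rewrite nth_iota //.
  by rewrite -[ltnRHS](size_iota 0) -has_find.
have /connectP[p xp ->] := connG x y; case/shortenP: xp => q xq uq _.
apply/hasP; exists (size q); last first.
  by apply/existsP; exists (in_tuple q); rewrite xq /=.
rewrite mem_iota /= add0n; have := max_card (mem (x :: q)).
by rewrite (card_uniqP uq).
Qed.

Lemma dist_eq0 x y : (dist x y == 0) = (x == y).
Proof.
apply/eqP/eqP => [d0|->]; last exact: distxx.
by have := walk_dist x y; rewrite d0 walk0 => /eqP.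
Qed.

Lemma dist_gt0 x y : (0 < dist x y) = (x != y).
Proof. by rewrite lt0n dist_eq0. Qed.

Lemma dist_adj x y z : adj x z -> dist x y <= (dist z y).+1.
Proof.
move=> xz; apply: dist_min; rewrite walkS; apply/existsP; exists z.
by rewrite xz walk_dist.
Qed.

Lemma dist_step x y : x != y -> exists2 z, adj x z & dist x y = (dist z y).+1.
Proof.
rewrite -dist_gt0 => d_gt0; have := walk_dist x y.
rewrite -(prednK d_gt0) walkS => /existsP[z /andP[xz wz]]; exists z => //.
apply/eqP; rewrite eqSS eqn_leq (dist_min wz) andbT.
by have := dist_adj y xz; lia.
Qed.

Lemma dist_gt k x y :
  x != y -> (forall z, adj x z -> k <= dist z y) -> k < dist x y.
Proof. by move=> /dist_step[z xz ->] H; rewrite ltnS H. Qed.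

Lemma dist_gt1 x y : x != y -> ~~ adj x y -> 1 < dist x y.
Proof.
move=> xy Nxy; apply: dist_gt => // z xz; rewrite dist_gt0.
by apply: contraNneq Nxy => <-.
Qed.

Lemma dist_adj1 x y : adj x y -> dist x y = 1.
Proof.
move=> xy; apply/eqP; rewrite eqn_leq -{1}(distxx y) dist_adj //= dist_gt0.
by apply: contraTneq xy => ->; rewrite adj_irr.
Qed.

Lemma dist_triangle x y z : dist x z <= dist x y + dist y z.
Proof.
move: {2}(dist x y) (erefl (dist x y)) => k; elim: k x => [|k IHk] x dxy.
  by have /eqP := dxy; rewrite dist_eq0 => /eqP->; rewrite distxx.
have [t xt dx] : exists2 t, adj x t & dist x y = (dist t y).+1.
  by apply: dist_step; rewrite -dist_gt0 dxy.
by have := dist_adj z xt; have := IHk t; lia.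
Qed.

Lemma dist_sym x y : dist x y = dist y x.
Proof.
suff le_d (u v : G) : dist u v <= dist v u by apply/eqP; rewrite eqn_leq !le_d.
move: {2}(dist v u) (erefl (dist v u)) => k; elim: k v => [|k IHk] v dvu.
  by have /eqP := dvu; rewrite dist_eq0 => /eqP->; rewrite distxx.
have [t vt dv] : exists2 t, adj v t & dist v u = (dist t u).+1.
  by apply: dist_step; rewrite -dist_gt0 dvu.
have := dist_triangle u t v; have := IHk t.
by rewrite (dist_adj1 (x := t) (y := v)) 1?adj_sym //; lia.
Qed.

Lemma dist_ecc x y : dist x y <= ecc y.
Proof. exact: (leq_bigmax (F := fun x => dist x y)). Qed.

Lemma ecc_leP k y : reflect (forall x, dist x y <= k) (ecc y <= k).
Proof.
by apply: (iffP (bigmax_leqP _ _ _)) => H x; [apply: H | move=> _; apply: H].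
Qed.

Lemma ecc_gtP k y : reflect (exists x, k < dist x y) (k < ecc y).
Proof.
rewrite ltnNge; apply: (iffP idP) => [/ecc_leP H|[x lt_k]]; last first.
  by apply/ecc_leP => /(_ x); rewrite leqNgt lt_k.
apply/existsP; apply: contra_notT H; rewrite negb_exists => /forallP H x.
by rewrite leqNgt.
Qed.

End Distance.

(** * Degrees, vertex covers, and graphs of radius at least 3 *)

Lemma sum_eq_op (T : finType) (x : T) : \sum_y (y == x) = 1.
Proof. by rewrite (bigD1 x) //= eqxx big1 // => y /negbTE->. Qed.

Lemma sum_mem (T : finType) (P : pred T) : \sum_x (x \in P) = #|P|.
Proof. by rewrite -sum1_card [RHS]big_mkcond; apply: eq_bigr => x _; case: ifP. Qed.

Lemma sum_const (T : finType) k : \sum_(x : T) k = #|T| * k.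
Proof. by rewrite big_const iter_addn addn0 mulnC. Qed.

Lemma sum_mulr (T : finType) k (F : T -> nat) :
  \sum_x k * F x = k * \sum_x F x.
Proof. by rewrite big_distrr. Qed.

Lemma sum_mull (T : finType) k (F : T -> nat) :
  \sum_x F x * k = (\sum_x F x) * k.
Proof. by rewrite big_distrl. Qed.

Lemma sum_add (T : finType) (F H : T -> nat) :
  \sum_x (F x + H x) = \sum_x F x + \sum_x H x.
Proof. exact: big_split. Qed.

Section Degrees.

Variable G : sgraph.
Implicit Types (x y z u v w : G).

Definition deg x := \sum_y adj x y.

Lemma adj_edges x y : adj x y -> [set x; y] \in edges G.
Proof. by move=> xy; apply/imsetP; exists (x, y); rewrite ?inE. Qed.

Lemma edgesP (E : {set G}) :
  reflect (exists x y, adj x y /\ E = [set x; y]) (E \in edges G).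
Proof.
apply: (iffP imsetP) => [[[x y] /[!inE] xy ->]|[x [y [xy ->]]]]; first by exists x, y.
by exists (x, y); rewrite ?inE.
Qed.

Lemma set2_inj x y u v :
  [set x; y] = [set u; v] -> (x = u /\ y = v) \/ (x = v /\ y = u).
Proof.
move=> E; have: x \in [set u; v] by rewrite -E set21.
have: y \in [set u; v] by rewrite -E set22.
have: u \in [set x; y] by rewrite E set21.
have: v \in [set x; y] by rewrite E set22.
by rewrite !inE => /orP[] /eqP ? /orP[] /eqP ? /orP[] /eqP ? /orP[] /eqP ?;
  subst; auto.
Qed.

Lemma handshake : \sum_x deg x = 2 * #|edges G|.
Proof.
rewrite /deg pair_big /=.
rewrite (eq_bigr (fun p : G * G => if adj p.1 p.2 then 1 else 0)); last first.
  by move=> p _; case: ifP.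
rewrite -big_mkcond /=.
rewrite (partition_big (fun p : G * G => [set p.1; p.2]) (mem (edges G))) /=;
  last by move=> p; apply: adj_edges.
rewrite (eq_bigr (fun=> 2)); first by rewrite sum_nat_const mulnC.
move=> E /edgesP[x [y [xy ->]]].
rewrite (eq_bigl [in [set (x, y); (y, x)]]).
  rewrite sum1_card cards2; case: eqP => // -[xy'].
  by move: xy; rewrite xy' adj_irr.
move=> [u v]; rewrite !inE /=; apply/andP/orP => [[uv /eqP/set2_inj]|].
  by case=> -[-> ->]; rewrite eqxx; [left|right].
by case=> /eqP[-> ->]; rewrite ?(setUC [set y]) ?eqxx // adj_sym.
Qed.

Lemma unicyclic_deg : unicyclic G -> \sum_x deg x = 2 * #|G|.
Proof. by case=> _ ->; apply: handshake. Qed.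

(* Distinct edges of a matching meet the cover in distinct vertices. *)
Lemma matching_number_cover (C : {set G}) :
  (forall x y, adj x y -> (x \in C) || (y \in C)) -> matching_number G <= #|C|.
Proof.
move=> covC; apply/bigmax_leqP => M /andP[/subsetP subM trivM].
have hitC (E : {set G}) : E \in M -> E :&: C != set0.
  move=> /subM/edgesP[x [y [/covC/orP[] zC ->]]]; apply/set0Pn;
  by [exists x; rewrite !inE eqxx | exists y; rewrite !inE eqxx orbT].
pose M' := [set E :&: C | E : {set G} in M].
have trivIM : {in M &, injective (fun E => E :&: C)}.
  move=> E F EM FM EF; apply/eqP; apply: contraT => neqEF.
  have /set0Pn[z] := hitC E EM; rewrite inE => /andP[zE zC].
  have : z \in F :&: C by rewrite -EF inE zE.
  have /trivIsetP/(_ E F EM FM neqEF) := trivM.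
  by rewrite inE => /pred0P/(_ z) /=; rewrite zE /= => ->.
rewrite -(card_in_imset trivIM) -/M'.
apply: (@leq_trans (\sum_(E in M') #|E|)).
  rewrite -sum1_card; apply: leq_sum => E /imsetP[F /hitC + ->].
  by rewrite card_gt0.
have /eqP -> : \sum_(E in M') #|E| == #|cover M'|.
  rewrite -/(trivIset M'); apply/trivIsetP => _ _ /imsetP[E EM ->] /imsetP[F FM ->].
  move=> neqEF; have /trivIsetP/(_ E F EM FM) := trivM.
  move=> disj; apply: disjointWl (subsetIl _ _) _.
  apply: disjointWr (subsetIl _ _) _; apply: disj.
  by apply: contraNneq neqEF => ->.
apply: subset_leq_card; apply/subsetP => z /bigcupP[E].
by move=> /imsetP[F _ ->]; rewrite inE => /andP[].
Qed.

Hypothesis connG : connected G.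

Lemma dist_level k v u : k <= dist u v -> exists x, dist x v = k.
Proof.
move: {2}(dist u v) (erefl (dist u v)) => m; elim: m u => [|m IHm] u du.
  by rewrite du leqn0 => /eqP->; exists u.
rewrite leq_eqVlt => /predU1P[->|]; first by exists u.
have [z _ dz] : exists2 z, adj u z & dist u v = (dist z v).+1.
  by apply: dist_step; rewrite // -dist_gt0 // du.
by rewrite dz ltnS => /IHm; apply; lia.
Qed.

Lemma deg_gt0 x y : x != y -> 0 < deg x.
Proof.
move=> /(dist_step connG)[z xz _]; rewrite /deg (bigD1 z) //= xz.
exact: ltn_addr.
Qed.

Lemma deg1_adj x y z : deg x = 1 -> adj x y -> adj x z -> y = z.
Proof.
rewrite /deg => + xy xz; rewrite (bigD1 y) //= xy.
have [//|neq] := eqVneq z y; rewrite (bigD1 z) //= xz; lia.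
Qed.

(** Every vertex contributes at least 2, except [v] and its neighbours, and [u] contributes one
    more. As in most counts below, an inequality with indicator corrections is proved pointwise and
    then summed. *)
Lemma dist_sum_ge v u : 2 < dist u v -> 2 * #|G| <= (dist_sum v + deg v).+1.
Proof.
move=> du; suff: \sum_x (2 + (x == u)) <= \sum_x (dist x v + adj v x + 2 * (x == v)).
  rewrite !(sum_mulr, sum_mull, sum_add) !sum_eq_op sum_const -/(deg v) -/(dist_sum v).
  lia.
apply: leq_sum => x _.
have [->|xu] := eqVneq x u; first by lia.
have [->|xv] := eqVneq x v; first by lia.
have [vx|Nvx] := boolP (adj v x).
  by rewrite dist_adj1 // adj_sym.
by rewrite !addn0 dist_gt1 // adj_sym.
Qed.

(** There are vertices at distances 3 and 4, whose surplus 1 + 2 over 2 makes up for [v] and its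
    single neighbour. *)
Lemma dist_sum_leaf v u : deg v = 1 -> 3 < dist u v -> 2 * #|G| <= dist_sum v.
Proof.
move=> dv du.
have [x4 d4] := dist_level du; have [x3 d3] := dist_level (ltnW du).
suff: \sum_x (2 + 2 * (x == x4) + (x == x3))
      <= \sum_x (dist x v + adj v x + 2 * (x == v)).
  rewrite !(sum_mulr, sum_mull, sum_add) !sum_eq_op sum_const.
  rewrite -/(deg v) -/(dist_sum v); lia.
apply: leq_sum => x _.
have [->|x4'] := eqVneq x x4.
  have [E|_] := eqVneq x4 x3; last by lia.
  by move: d3; rewrite -E d4.
have [->|x3'] := eqVneq x x3; first by lia.
have [->|xv] := eqVneq x v; first by lia.
have [vx|Nvx] := boolP (adj v x).
  by rewrite dist_adj1 // adj_sym.
by rewrite !addn0 dist_gt1 // adj_sym.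
Qed.

(** Every walk leaving the leaf passes through [w], so a vertex at distance 3 from [w] is at
    distance 4 from [v]. *)
Lemma ecc_leaf v w : deg v = 1 -> adj v w -> 2 < ecc w -> 3 < ecc v.
Proof.
move=> dv vw /ecc_gtP[u /dist_level[z dz]].
apply/ecc_gtP; exists z; rewrite dist_sym //; apply: dist_gt => // [|t vt].
  apply: contra_eqN dz => /eqP <-; by rewrite dist_adj1.
by rewrite (deg1_adj dv vt vw) dist_sym // dz.
Qed.

(* A vertex at distance 2 from v is the end of a 2-path from v. *)
Lemma dist_sum_two_paths v :
  3 * #|G| <= dist_sum v + deg v + \sum_z adj v z * deg z + 3.
Proof.
(* The term [deg v * (x == v)] offsets the 2-paths that return to [v]. *)
suff: \sum_x (3 + deg v * (x == v))
   <= \sum_x (dist x v + 2 * adj v x + (\sum_z adj v z * adj z x) + 3 * (x == v)).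
  have paths : \sum_x \sum_z adj v z * adj z x = \sum_z adj v z * deg z.
    by rewrite exchange_big; apply: eq_bigr => z _; rewrite sum_mulr.
  rewrite !(sum_mulr, sum_mull, sum_add) !sum_eq_op sum_const paths.
  rewrite -/(deg v) -/(dist_sum v); lia.
apply: leq_sum => x _; have [->|xv] := eqVneq x v.
  suff <- : deg v = \sum_z adj v z * adj z v by lia.
  by apply: eq_bigr => z _; rewrite (adj_sym z); case: adj.
have [vx|Nvx] := boolP (adj v x).
  by rewrite dist_adj1 ?(adj_sym x) //; lia.
have : 1 < dist x v by rewrite dist_gt1 // adj_sym.
rewrite leq_eqVlt => /predU1P[d2|]; last by lia.
have [z xz dz] := dist_step connG xv.
have zv : adj v z.
  have : z != v by rewrite -(dist_gt0 connG); lia.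
  move=> neq; apply: contraT; rewrite adj_sym => /(dist_gt1 connG neq); lia.
by rewrite -d2 (bigD1 z) //= zv adj_sym xz; lia.
Qed.

(** A vertex at distance k has one of its two neighbours closer to [v], hence at most one farther
    away. *)
Lemma sphere_succ v k : 0 < k -> (forall x, deg x = 2) ->
  #|[pred x | dist x v == k.+1]| <= #|[pred x | dist x v == k]|.
Proof.
move=> k_gt0 deg2; rewrite -!sum1_card.
apply: (@leq_trans (\sum_(x | dist x v == k.+1) \sum_(y | dist y v == k) adj x y)).
  apply: leq_sum => x; rewrite inE => /eqP dx.
  have [y xy dy] : exists2 y, adj x y & dist x v = (dist y v).+1.
    by apply: dist_step; rewrite // -dist_gt0 // dx.
  rewrite (bigD1 y) /= ?xy //; last by rewrite -eqSS -dy dx.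
rewrite exchange_big /=; apply: leq_sum => y /eqP dy.
have [z yz dz] : exists2 z, adj y z & dist y v = (dist z v).+1.
  by apply: dist_step; rewrite // -dist_gt0 // dy.
rewrite -ltnS -(deg2 y) /deg [leqRHS](bigID (fun x => dist x v == k.+1)) /=.
rewrite (eq_bigr (fun x => adj y x : nat)); last by move=> x _; rewrite adj_sym.
rewrite -[X in X <= _]addn1 leq_add2l (bigD1 z) /= ?yz //; lia.
Qed.

End Degrees.

(** Two lower bounds complement each other: one grows with the number l of leaves, the other has
    leading term [9n^2] but loses the sum of the squared degrees, which l controls. *)
Lemma eds_radius3 (G : sgraph) : 9 <= #|G| -> unicyclic G ->
  (forall v : G, 2 < ecc v) -> 6 * #|G| ^ 2 + 17 * #|G| < eds G + 147.
Proof.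
move=> n_ge9 uniG ecc3; have connG := uniG.1.
have sum_deg := unicyclic_deg uniG.
have deg1 (v : G) : 0 < deg v.
  have [u /dist_level[//|x dx]] := ecc_gtP _ _ (ecc3 v).
  by apply: (@deg_gt0 _ connG _ x); rewrite eq_sym -(dist_gt0 connG) dx.
pose L := [pred x : G | deg x == 1]; pose l := #|L|; pose n := #|G|.
have ecc4 (v : G) : deg v = 1 -> 3 < ecc v.
  move=> dv; have : deg v != 0 by rewrite dv.
  rewrite sum_nat_eq0 negb_forall => /existsP[w]; rewrite eqb0 negbK => vw.
  exact: ecc_leaf vw _.
have leaf (v : G) : deg v = 1 -> 2 * n <= dist_sum v.
  move=> dv; have [u] := ecc_gtP _ _ (ecc4 v dv); exact: dist_sum_leaf.
have B1 : 6 * n ^ 2 + l * (2 * n + 6) <= eds G + 9 * n.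
  suff: \sum_(v : G) (6 * n + (v \in L) * (2 * n + 6))
        <= \sum_(v : G) (ecc v * dist_sum v + 3 * deg v + 3).
    rewrite !(sum_mulr, sum_mull, sum_add) sum_mem !sum_const sum_deg.
    by rewrite -/(eds G) -/l -/n; lia.
  apply: leq_sum => v _; rewrite inE; have [dv|_] := eqVneq (deg v) 1.
    have := leaf v dv; have := ecc4 v dv; rewrite dv => e4 D.
    have := leq_mul e4 D; lia.
  have [u du] := ecc_gtP _ _ (ecc3 v).
  have := dist_sum_ge connG du; rewrite -/n => D.
  have : 3 * dist_sum v <= ecc v * dist_sum v by rewrite leq_mul2r ecc3 orbT.
  lia.
pose s2 := \sum_(v : G) deg v ^ 2.
have B2 : 9 * n ^ 2 + 2 * n * l <= eds G + 3 * s2 + 15 * n.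
  suff: \sum_(v : G) (9 * n + (v \in L) * (2 * n))
        <= \sum_(v : G) (ecc v * dist_sum v + 3 * deg v
                          + 3 * (\sum_z adj v z * deg z) + 9).
    have sum_sq : \sum_(v : G) \sum_z adj v z * deg z = s2.
      rewrite exchange_big; apply: eq_bigr => z _ /=; rewrite sum_mull -mulnn.
      by congr (_ * _); apply: eq_bigr => x _; rewrite adj_sym.
    rewrite !(sum_mulr, sum_mull, sum_add) sum_mem !sum_const sum_deg sum_sq.
    by rewrite -/(eds G) -/l -/n -/s2; lia.
  apply: leq_sum => v _; rewrite inE; have := dist_sum_two_paths connG v.
  rewrite -/n => D; have [dv|_] := eqVneq (deg v) 1.
    have := leaf v dv => D'.
    have : 4 * dist_sum v <= ecc v * dist_sum v by rewrite leq_mul2r ecc4 ?orbT.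
    lia.
  have : 3 * dist_sum v <= ecc v * dist_sum v by rewrite leq_mul2r ecc3 orbT.
  lia.
(* In a unicyclic graph the average degree is 2, so the excesses over 2 balance the deficits, which
   are 1 at each leaf; the truncated subtraction keeps only the excesses. *)
have sum_ex : \sum_(v : G) (deg v - 2) = l.
  suff: \sum_(v : G) (deg v + (v \in L)) = \sum_(v : G) (2 + (deg v - 2)).
    by rewrite !sum_add sum_mem sum_const sum_deg -/l; lia.
  by apply: eq_bigr => v _; have := deg1 v; rewrite inE; case: eqP => /=; lia.
have s2_le : s2 <= l ^ 2 + l + 4 * n.
  suff: \sum_(v : G) (deg v ^ 2 + 3 * (v \in L))
      <= \sum_(v : G) (4 + 4 * (deg v - 2) + (deg v - 2) * l).
    rewrite !(sum_mulr, sum_mull, sum_add) sum_mem !sum_const sum_ex.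
    by rewrite -/s2 -/l -/n; lia.
  apply: leq_sum => v _; have ex_le : deg v - 2 <= l.
    by rewrite -sum_ex (bigD1 v) //= leq_addr.
  have := deg1 v; rewrite inE; case: eqP => [->|] //=; nia.
have [l0|l_gt0] := posnP l; last first.
  rewrite -/n in n_ge9 *.
  (* From 13 leaves on [B1] is enough, as 2 * 13 = 17 + 9. With fewer leaves [B2] serves for large
     n, and 9 <= n <= 12 leaves finitely many linear checks. *)
  have [l_ge13|l_lt13] := leqP 13 l; first by nia.
  have [n_ge13|n_lt13] := leqP 13 n.
    have : l ^ 2 <= 12 * l by nia.
    nia.
  clearbody s2 l n; clear -n_ge9 n_lt13 B1 B2 s2_le l_gt0 l_lt13.
  move: (eds G) n n_ge9 n_lt13 l l_gt0 l_lt13 s2 s2_le B1 B2 => e.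
  move=> [|[|[|[|[|[|[|[|[|[|[|[|[|n]]]]]]]]]]]]] // _ _
    [|[|[|[|[|[|[|[|[|[|[|[|[|l]]]]]]]]]]]]] // _ _; lia.
(* Without leaves the graph is 2-regular and [B2] gives [9n^2 - 27n]. For n = 9 this is 486, below
   the target 492, so the eccentricities of the 9-cycle are raised to 4. *)
have [n10|n9] := ltnP 9 #|G|; first by rewrite -/n in n10 *; nia.
have {}n9 : n = 9 by rewrite /n; lia.
have deg2 (v : G) : deg v = 2.
  have : deg v - 2 <= l by rewrite -sum_ex (bigD1 v) //= leq_addr.
  have : v \notin L by apply/negP => vL; have := card0_eq l0 v; rewrite vL.
  have := deg1 v; rewrite inE l0; lia.
(* Eccentricity at most 3 would leave room for only 1 + 2 + 2 + 2 = 7 vertices. *)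
have ecc4' (v : G) : 3 < ecc v.
  rewrite ltnNge; apply/negP => /ecc_leP ecc_le3.
  have := sphere_succ connG v (k := 1) isT deg2.
  have := sphere_succ connG v (k := 2) isT deg2.
  have : #|[pred x | dist x v == 1]| <= 2.
    rewrite -(deg2 v) -sum_mem; apply: leq_sum => x _; rewrite inE.
    case: eqP => // dx; rewrite lt0b; apply: contraT; rewrite adj_sym.
    have xv : x != v by rewrite -(dist_gt0 connG) dx.
    by move=> Nxv; have := dist_gt1 connG xv Nxv; rewrite dx.
  suff: n <= 1 + #|[pred x | dist x v == 1]| + #|[pred x | dist x v == 2]|
            + #|[pred x | dist x v == 3]| by lia.
  suff: \sum_(x : G) 1 <= \sum_x ((x == v) + (dist x v == 1) + (dist x v == 2)
                                   + (dist x v == 3)).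
    by rewrite sum_const muln1 !sum_add sum_eq_op !(sum_mem [pred x | dist x v == _]).
  apply: leq_sum => x _; rewrite -(dist_eq0 connG).
  by have := ecc_le3 x; case: (dist x v) => [|[|[|[|?]]]] //=.
have: \sum_(v : G) (4 * 27) <= \sum_(v : G) (ecc v * dist_sum v + 4 * (2 + 4 + 3)).
  apply: leq_sum => v _; have := dist_sum_two_paths connG v.
  rewrite deg2 (eq_bigr (fun z => 2 * adj v z)); last first.
    by move=> z _; rewrite deg2 mulnC.
  rewrite !sum_mulr -/(deg v) deg2 -/n n9.
  have : 4 * dist_sum v <= ecc v * dist_sum v by rewrite leq_mul2r ecc4' orbT.
  lia.
rewrite sum_add /= -/(eds G) !sum_const -/n n9; lia.
Qed.

(** * Unicyclic graphs of radius at most 2 *)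

(* A breadth-first tree of height at most 2 rooted at [c], given by the parent
   function [par], together with the only edge [s]-[t] outside the tree. *)
Record hubbed (G : sgraph) (c : G) (par : G -> G) (s t : G) : Prop := Hubbed {
  par_hub : par c = c;
  par_par : forall x, par (par x) = c;
  hub_s : s != c;
  hub_t : t != c;
  hub_st : s != t;
  hub_pst : par s != t;
  hub_pts : par t != s;
  hub_adj : forall x y, adj x y =
    [|| (x != c) && (par x == y), (y != c) && (par y == x),
        (x == s) && (y == t) | (x == t) && (y == s)] }.

Lemma hubbed_sym (G : sgraph) (c : G) par s t :
  hubbed c par s t -> hubbed c par t s.
Proof.
case=> pc pp sc tc st ps pt adjE; split=> //; first by rewrite eq_sym.
by move=> x y; rewrite adjE [(x == t) && _ || _]orbC.
Qed.

(** The edges [[set x; par x]] with [x != c] are distinct, because [par x = y] and [par y = x] would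
    give [x = c]. They form all but one of the [#|G|] edges, and the last one is s-t. The default
    value of [odflt] is not reached, as [ecc c <= 2]. *)
Lemma hubbed_exists (G : sgraph) (c : G) :
  unicyclic G -> ecc c <= 2 -> exists par s t, hubbed c par s t.
Proof.
move=> [connG cardG] /ecc_leP ecc_c.
pose par x := if (x == c) || adj x c then c else
  odflt c [pick z | adj x z && adj z c].
have par_c : par c = c by rewrite /par eqxx.
have par_adj x : x != c -> adj x (par x).
  rewrite /par => /negbTE xc; rewrite xc /=; case: ifP => // Nxc.
  case: pickP => [z /andP[]//|no_z].
  have [z xz dz] := dist_step connG (negbT xc).
  have := ecc_c x; rewrite dz ltnS leq_eqVlt ltnS leqn0 (dist_eq0 connG).
  case/predU1P=> [d1|/eqP zc]; last by rewrite zc Nxc in xz.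
  have [u zu du] : exists2 u, adj z u & dist z c = (dist u c).+1.
    by apply: dist_step; rewrite // -(dist_gt0 connG) d1.
  have /eqP : dist u c = 0 by lia.
  rewrite dist_eq0 // => /eqP uc; rewrite uc in zu.
  by have := no_z z; rewrite xz zu.
have par2 x : par (par x) = c.
  rewrite {2}/par; case: ifP => // _; case: pickP => [z /andP[_ zc]|_] //=.
  by rewrite /par zc orbT.
pose T := [set [set x; par x] | x in [pred x | x != c]].
have sub_T : T \subset edges G.
  apply/subsetP => _ /imsetP[x /[!inE] xc ->].
  by apply: adj_edges; apply: par_adj.
have card_T : #|G| = #|T|.+1.
  rewrite card_in_imset; last first.
    move=> x y /[!inE] xc yc /set2_inj[[]//|[xy yx]].
    by have := par2 x; rewrite yx -xy => E; rewrite E eqxx in xc.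
  rewrite [LHS](cardD1 c) -[RHS]add1n; congr addn.
  by apply: eq_card => x; rewrite !inE andbT.
have : #|edges G :\: T| = 1.
  by rewrite cardsD (setIidPr sub_T) -cardG card_T subSnn.
case/eqP/cards1P=> E defE; have : E \in edges G :\: T by rewrite defE inE.
rewrite inE => /andP[ET] /edgesP[s [t [st defst]]].
have sc : s != c.
  apply: contraNneq ET => sc; rewrite defst sc setUC; apply/imsetP.
  have tc : t != c by apply: contraTneq st => ->; rewrite sc adj_irr.
  exists t; rewrite ?inE //; congr [set _; _].
  have ac : adj t c by rewrite -sc adj_sym.
  by rewrite /par ac orbT.
have tc : t != c.
  apply: contraNneq ET => tc; rewrite defst tc; apply/imsetP.
  have ac : adj s c by rewrite -tc.
  by exists s; rewrite ?inE //; congr [set _; _]; rewrite /par ac orbT.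
exists par, s, t; split=> //.
- by apply: contraTneq st => ->; rewrite adj_irr.
- apply: contraNneq ET => ps; rewrite defst -ps; apply/imsetP.
  by exists s; rewrite ?inE.
- apply: contraNneq ET => ps; rewrite defst -ps setUC; apply/imsetP.
  by exists t; rewrite ?inE.
move=> x y; apply/idP/idP => [xy|].
  have [|NT] := boolP ([set x; y] \in T).
    case/imsetP=> z /[!inE] zc /set2_inj[[-> ->]|[-> ->]].
      by rewrite zc eqxx.
    by rewrite zc eqxx /= !orbT.
  have : [set x; y] \in edges G :\: T by rewrite inE NT adj_edges.
  rewrite defE inE defst => /eqP/set2_inj[[-> ->]|[-> ->]];
  by rewrite !eqxx !orbT.
case/or4P=> /andP[].
- by move=> /par_adj + /eqP<-.
- by rewrite adj_sym => /par_adj + /eqP<-.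
- by move=> /eqP-> /eqP->.
- by move=> /eqP-> /eqP->; rewrite adj_sym.
Qed.

(** * Distances in terms of branches at the hub *)

Lemma lipschitz_dist (G : sgraph) (g : G -> nat) : connected G ->
  (forall x y, adj x y -> g x <= (g y).+1) ->
  forall x y, g x <= g y + dist x y.
Proof.
move=> connG lip x y.
move: {2}(dist x y) (erefl (dist x y)) => m; elim: m x => [|m IHm] x dxy.
  by have /eqP := dxy; rewrite dist_eq0 // => /eqP->; apply: leq_addr.
have [z xz dz] : exists2 z, adj x z & dist x y = (dist z y).+1.
  by apply: dist_step; rewrite // -(dist_gt0 connG) dxy.
by have := lip x z xz; have := IHm z; lia.
Qed.

Lemma sum_eq_in (T : finType) (P : {set T}) (y : T) :
  \sum_(x in P) (x == y) = (y \in P).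
Proof.
have [yP|/negbTE yP] := boolP (y \in P).
  by rewrite (bigD1 y) //= eqxx big1 // => x /andP[_ /negbTE->].
by rewrite big1 // => x xP; case: eqP xP => // ->; rewrite yP.
Qed.

Lemma sum_mulr_in (T : finType) (P : {set T}) k (F : T -> nat) :
  \sum_(x in P) k * F x = k * \sum_(x in P) F x.
Proof. by rewrite big_distrr. Qed.

Lemma sum_mull_in (T : finType) (P : {set T}) k (F : T -> nat) :
  \sum_(x in P) F x * k = (\sum_(x in P) F x) * k.
Proof. by rewrite big_distrl. Qed.

Lemma sum_add_in (T : finType) (P : {set T}) (F H : T -> nat) :
  \sum_(x in P) (F x + H x) = \sum_(x in P) F x + \sum_(x in P) H x.
Proof. exact: big_split. Qed.

Lemma sum_mem_in (T : finType) (P : {set T}) (Q : pred T) :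
  \sum_(x in P) Q x = #|[set x in P | Q x]|.
Proof.
rewrite -sum1_card [LHS]big_mkcond [RHS]big_mkcond; apply: eq_bigr => x _ /=.
by rewrite inE; case: (x \in P); case: (Q x).
Qed.

Section Hub.

Variables (G : sgraph) (c : G) (par : G -> G) (s t : G).
Hypotheses (connG : connected G) (hubG : hubbed c par s t).
Implicit Types (x y z u v w : G).

Definition inner := [set x | (x != c) && (par x == c)].
Definition outer := [set x | par x != c].
(** The branch containing [x], named by its vertex next to the hub; [c] is its own top. *)
Definition top x := if par x == c then x else par x.
Definition depth x := (x != c) + (par x != c).

Local Notation a := #|inner|.
Local Notation b := #|outer|.

Lemma outer_neq w : w \in outer -> w != c.
Proof. by rewrite !inE; apply: contraNneq => ->; rewrite (par_hub hubG). Qed.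

Lemma par_inner w : w \in outer -> par w \in inner.
Proof. by rewrite !inE (par_par hubG) eqxx andbT. Qed.

Lemma hub_cases x : [\/ x = c, x \in inner | x \in outer].
Proof.
have [->|xc] := eqVneq x c; first by constructor 1.
by have [px|px] := boolP (par x == c); [constructor 2|constructor 3];
  rewrite inE ?xc.
Qed.

Lemma sum_hub (F : G -> nat) :
  \sum_x F x = F c + \sum_(x in inner) F x + \sum_(x in outer) F x.
Proof.
rewrite (bigID (mem outer)) /= addnC (bigD1 c) /=; last first.
  by rewrite inE (par_hub hubG) eqxx.
congr (_ + _ + _); apply: eq_bigl => x; rewrite !inE ?negbK 1?andbC //.
Qed.

Lemma card_hub : #|G| = 1 + a + b.
Proof. by have := sum_hub (fun=> 1); rewrite sum_const muln1 !sum1_card. Qed.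

Lemma adj_par x : x != c -> adj x (par x).
Proof. by move=> xc; rewrite (hub_adj hubG) xc eqxx. Qed.

Lemma adj_st : adj s t.
Proof. by rewrite (hub_adj hubG) !eqxx !orbT. Qed.

Lemma depth_inner v : v \in inner -> depth v = 1.
Proof. by rewrite inE /depth => /andP[-> /eqP->]; rewrite eqxx. Qed.

Lemma depth_outer w : w \in outer -> depth w = 2.
Proof. by move=> wB; rewrite /depth (outer_neq wB); move: wB; rewrite inE => ->. Qed.

Lemma top_inner v : v \in inner -> top v = v.
Proof. by rewrite inE /top => /andP[_ ->]. Qed.

Lemma top_outer w : w \in outer -> top w = par w.
Proof. by rewrite inE /top => /negbTE->. Qed.

Lemma inner_neq v : v \in inner -> v != c.
Proof. by rewrite inE => /andP[]. Qed.

Lemma inner_outer v w : v \in inner -> w \in outer -> v != w.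
Proof.
by rewrite !inE => /andP[_ pv]; apply: contraNneq => <-.
Qed.

Lemma dist_hub x : dist x c = depth x.
Proof.
case: (hub_cases x) => [->|xA|xB].
- by rewrite distxx /depth (par_hub hubG) eqxx.
- rewrite (depth_inner xA) dist_adj1 //.
  by move: xA; rewrite inE => /andP[/adj_par + /eqP pc]; rewrite pc.
rewrite (depth_outer xB); have xc := outer_neq xB.
apply/eqP; rewrite eqn_leq; apply/andP; split.
  apply: leq_trans (dist_adj connG c (adj_par xc)) _.
  have pA := par_inner xB; rewrite ltnS dist_adj1 //.
  by have := adj_par (inner_neq pA); rewrite (par_par hubG).
apply: dist_gt1 => //; rewrite (hub_adj hubG) eqxx /= xc.
rewrite [c == t]eq_sym [c == s]eq_sym (negbTE (hub_s hubG)) (negbTE (hub_t hubG)).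
by move: xB; rewrite inE => /negbTE->; rewrite !andbF.
Qed.

Lemma dist_hub_le x y : dist x y <= depth x + depth y.
Proof.
have := dist_triangle connG x c y; rewrite (dist_sym connG c) !dist_hub; lia.
Qed.

(* The map z |-> 2 -+ depth z, with the sign given by P, is 1-Lipschitz. *)
Lemma dist_sep (P : pred G) x y : P (top s) = P (top t) ->
  x != c -> y != c -> P (top x) != P (top y) -> depth x + depth y <= dist x y.
Proof.
move=> Pst.
wlog Px : x y / P (top x).
  move=> IH xc yc neqP; have [Px|NPx] := boolP (P (top x)); first exact: IH.
  rewrite dist_sym // addnC; apply: IH => //; last by rewrite eq_sym.
  by move: neqP; rewrite (negbTE NPx); case: (P (top y)).
move=> xc yc; rewrite Px eq_sym eqb_id => /negbTE Py.
pose g z := if z == c then 2 else if P (top z) then 2 - depth z else 2 + depth z.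
have dep_le z : depth z <= 2 by rewrite /depth; case: eqP; case: eqP.
have gE z : z != c -> g z = if P (top z) then 2 - depth z else 2 + depth z.
  by rewrite /g => /negbTE->.
have g_par z : z != c -> g z <= (g (par z)).+1 /\ g (par z) <= (g z).+1.
  move=> zc; rewrite gE //; case: (hub_cases z) => [E|zA|zB].
  - by rewrite E eqxx in zc.
  - rewrite (depth_inner zA); move: zA; rewrite inE => /andP[_ /eqP->].
    by rewrite /g eqxx; case: ifP.
  have pA := par_inner zB; rewrite gE ?inner_neq //.
  rewrite (depth_outer zB) (depth_inner pA) (top_outer zB) (top_inner pA).
  by case: ifP.
have g_st : g s <= (g t).+1 /\ g t <= (g s).+1.
  have [sc tc] := (hub_s hubG, hub_t hubG); rewrite !gE // Pst.
  have := dep_le s; have := dep_le t.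
  have : 0 < depth s by rewrite /depth sc.
  have : 0 < depth t by rewrite /depth tc.
  by case: ifP; lia.
have lip u v : adj u v -> g u <= (g v).+1.
  rewrite (hub_adj hubG) => /or4P[] /andP[].
  - by move=> uc /eqP<-; case: (g_par u uc).
  - by move=> vc /eqP<-; case: (g_par v vc).
  - by move=> /eqP-> /eqP->; case: g_st.
  - by move=> /eqP-> /eqP->; case: g_st.
have := lipschitz_dist connG lip y x.
rewrite !gE // Px Py dist_sym //; have := dep_le x; lia.
Qed.

(** One of the predicates of being the branch of [x], or of being that of [y], gives the same answer
    on both ends of the extra edge: otherwise each branch would contain exactly one end. *)
Lemma dist_branch x y : x != c -> y != c -> top x != top y ->
  ~~ ((top x == top s) && (top y == top t)) ->
  ~~ ((top x == top t) && (top y == top s)) -> depth x + depth y <= dist x y.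
Proof.
move=> xc yc neq st ts.
have [Ex|Nx] := boolP ((top s == top x) == (top t == top x)).
  apply: (@dist_sep (pred1 (top x))) => //=; first exact: (eqP Ex).
  by rewrite eqxx [top y == _]eq_sym (negbTE neq).
have [Ey|Ny] := boolP ((top s == top y) == (top t == top y)).
  apply: (@dist_sep (pred1 (top y))) => //=; first exact: (eqP Ey).
  by rewrite eqxx (negbTE neq).
move: Nx Ny st ts; rewrite ![_ == top s]eq_sym ![_ == top t]eq_sym.
have [E|] := eqVneq (top s) (top x); have [E'|] := eqVneq (top t) (top x) => //=;
have [E1|] := eqVneq (top s) (top y); have [E2|] := eqVneq (top t) (top y) => //=.
- by move: neq; rewrite -E E1 eqxx.
- by move: neq; rewrite -E' E2 eqxx.
Qed.

Lemma dist_ge2 x y : 2 <= dist x y + 2 * (x == y) + adj x y.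
Proof.
have [->|xy] := eqVneq x y; first by lia.
have [xy1|Nxy] := boolP (adj x y); last by have := dist_gt1 connG xy Nxy; lia.
by rewrite dist_adj1.
Qed.

Lemma hub_dist_sum v : dist_sum v = depth v
  + \sum_(u in inner) dist u v + \sum_(u in outer) dist u v.
Proof. by rewrite /dist_sum sum_hub dist_sym // dist_hub. Qed.

Lemma dist_sum_hub : dist_sum c = a + 2 * b.
Proof.
rewrite hub_dist_sum /depth (par_hub hubG) eqxx /=.
rewrite (eq_bigr (fun=> 1)) => [|v vA]; last by rewrite dist_hub depth_inner.
rewrite [X in _ + X](eq_bigr (fun=> 2)) => [|v vB].
  by rewrite !sum_nat_const; lia.
by rewrite dist_hub depth_outer.
Qed.

(** [dAA] and [dBB] run over ordered pairs, so they count each pair of vertices twice, while [dAB]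
    counts it once. *)
Definition dAA := \sum_(v in inner) \sum_(u in inner) dist u v.
Definition dAB := \sum_(v in inner) \sum_(u in outer) dist u v.
Definition dBB := \sum_(v in outer) \sum_(u in outer) dist u v.

Lemma dist_sum_inner : \sum_(v in inner) dist_sum v = a + dAA + dAB.
Proof.
rewrite (eq_bigr (fun v => 1 + \sum_(u in inner) dist u v
                             + \sum_(u in outer) dist u v)) => [|v vA].
  by rewrite !sum_add_in sum_nat_const muln1.
by rewrite hub_dist_sum depth_inner.
Qed.

Lemma dist_sum_outer : \sum_(v in outer) dist_sum v = 2 * b + dAB + dBB.
Proof.
rewrite (eq_bigr (fun v => 2 + \sum_(u in inner) dist u v
                             + \sum_(u in outer) dist u v)) => [|v vA].
  rewrite !sum_add_in sum_nat_const mulnC /dAB exchange_big /=.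
  by congr (_ + _ + _); apply: eq_bigr => u _; apply: eq_bigr => v _; apply: dist_sym.
by rewrite hub_dist_sum depth_outer.
Qed.

Lemma dAA_ge al : \sum_(v in inner) \sum_(u in inner) adj u v <= al ->
  2 * a ^ 2 <= dAA + 2 * a + al.
Proof.
move=> le_al; suff: \sum_(v in inner) \sum_(u in inner) 2 <=
  \sum_(v in inner) \sum_(u in inner) (dist u v + 2 * (u == v) + adj u v).
  rewrite !sum_nat_const.
  rewrite (eq_bigr (fun v => (\sum_(u in inner) dist u v) + 2
                             + \sum_(u in inner) adj u v)) => [|v vA]; last first.
    by rewrite !(sum_mulr_in, sum_add_in) sum_eq_in vA.
  by rewrite !sum_add_in sum_nat_const -/dAA; lia.
by apply: leq_sum => v _; apply: leq_sum => u _; apply: dist_ge2.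
Qed.

(** The generic distance is 3, going through the hub; the parent of [w] loses 2, and [e] bounds the
    shortfall due to the extra edge, with total [be]. *)
Lemma dAB_ge (e : G -> G -> nat) be :
  (forall v w, v \in inner -> w \in outer ->
     3 <= dist w v + 2 * (v == par w) + e v w) ->
  \sum_(v in inner) \sum_(w in outer) e v w <= be ->
  3 * a * b <= dAB + 2 * b + be.
Proof.
move=> ge3 le_be; suff: \sum_(v in inner) \sum_(w in outer) 3 <=
  \sum_(v in inner) \sum_(w in outer) (dist w v + 2 * (v == par w) + e v w).
  have parE : \sum_(v in inner) \sum_(w in outer) (v == par w) = b.
    rewrite exchange_big /= -sum1_card; apply: eq_bigr => w wB.
    by rewrite sum_eq_in par_inner.
  rewrite !sum_nat_const.
  rewrite (eq_bigr (fun v => (\sum_(w in outer) dist w v)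
     + 2 * (\sum_(w in outer) (v == par w)) + \sum_(w in outer) e v w)).
    by rewrite !(sum_mulr_in, sum_add_in) parE -/dAB; lia.
  by move=> v vA; rewrite !(sum_mulr_in, sum_add_in).
by apply: leq_sum => v vA; apply: leq_sum => u uB; apply: ge3.
Qed.

(** * Splitting the branches into two classes not joined by the extra edge *)

Section Split.

Variable P : pred G.
Hypothesis Pst : P (top s) = P (top t).
Let K := [set w in outer | P (par w)].
Let R := [set w in outer | ~~ P (par w)].

Lemma split_far w w' : w \in K -> w' \in R -> 3 < dist w w'.
Proof.
rewrite [w \in K]inE [w' \in R]inE => /andP[wB Pw] /andP[w'B Pw'].
rewrite -[4](addnn 2) -{1}(depth_outer wB) -(depth_outer w'B).
apply: (@dist_sep P); rewrite ?outer_neq // !top_outer //.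
by rewrite Pw (negbTE Pw').
Qed.

(** A pair across the split is at distance at least 4 instead of 2; over both orders this adds 4 per
    pair. *)
Lemma dBB_ge ga : \sum_(v in outer) \sum_(u in outer) adj u v <= ga ->
  2 * b ^ 2 + 4 * #|K| * #|R| <= dBB + 2 * b + ga.
Proof.
move=> le_ga.
suff: \sum_(v in outer) \sum_(u in outer)
        (2 + 2 * (P (par v) * ~~ P (par u) + ~~ P (par v) * P (par u))) <=
  \sum_(v in outer) \sum_(u in outer) (dist u v + 2 * (u == v) + adj u v).
  rewrite (eq_bigr (fun v => b * 2 + 2 * (P (par v) * #|R| + ~~ P (par v) * #|K|)))
    => [|v vB]; last first.
    rewrite !(sum_mulr_in, sum_add_in) sum_nat_const.
    by rewrite (sum_mem_in _ (fun u => P (par u)))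
               (sum_mem_in _ (fun u => ~~ P (par u))).
  rewrite !(sum_mulr_in, sum_mull_in, sum_add_in) !sum_nat_const.
  rewrite (sum_mem_in _ (fun u => P (par u))) (sum_mem_in _ (fun u => ~~ P (par u))).
  rewrite -/K -/R.
  rewrite (eq_bigr (fun v => (\sum_(u in outer) dist u v) + 2
                             + \sum_(u in outer) adj u v)) => [|v vB]; last first.
    by rewrite !(sum_mulr_in, sum_add_in) sum_eq_in vB.
  by rewrite !sum_add_in sum_nat_const -/dBB; lia.
apply: leq_sum => v vB; apply: leq_sum => u uB.
have [Pv|Pv] := boolP (P (par v)); have [Pu|Pu] := boolP (P (par u));
  rewrite ?addn0 ?muln0; try exact: dist_ge2.
- have : 3 < dist v u by apply: split_far; rewrite inE ?vB ?uB.
  by rewrite (dist_sym connG); lia.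
- have : 3 < dist u v by apply: split_far; rewrite inE ?vB ?uB.
  by lia.
Qed.

(** Whichever class a vertex belongs to, an outer vertex of the other class is as far from it as the
    depths allow, which gives the eccentricities 3 and 4. The defects [al], [be], [ga] of the three
    distance sums are then weighted by 3, 3 + 4 and 4. *)
Lemma eds_split al be ga (e : G -> G -> nat) :
  0 < #|K| -> 0 < #|R| ->
  \sum_(v in inner) \sum_(u in inner) adj u v <= al ->
  (forall v w, v \in inner -> w \in outer ->
     3 <= dist w v + 2 * (v == par w) + e v w) ->
  \sum_(v in inner) \sum_(w in outer) e v w <= be ->
  \sum_(v in outer) \sum_(u in outer) adj u v <= ga ->
  6 * a ^ 2 + 21 * a * b + 8 * b ^ 2 + 16 * #|K| * #|R|
    <= eds G + a + 10 * b + 3 * al + 7 * be + 4 * ga.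
Proof.
move=> /card_gt0P[k kK] /card_gt0P[r rR] /dAA_ge AA /dAB_ge AB /AB{}AB /dBB_ge BB.
have [kB Pk] : k \in outer /\ P (par k) by move: kK; rewrite inE => /andP.
have [rB Pr] : r \in outer /\ ~~ P (par r) by move: rR; rewrite inE => /andP.
have ecc_c : 2 <= ecc c by rewrite -(depth_outer kB) -dist_hub dist_ecc.
have ecc_inner v : v \in inner -> 3 <= ecc v.
  move=> vA; have dep w : w \in outer -> depth w + depth v = 3.
    by move=> wB; rewrite depth_outer // depth_inner.
  have [Pv|Pv] := boolP (P v).
    rewrite -(dep r) //; apply: leq_trans (dist_ecc r v).
    apply: (@dist_sep P); rewrite ?(outer_neq rB) ?(inner_neq vA) //.
    by rewrite top_outer // top_inner // Pv (negbTE Pr).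
  rewrite -(dep k) //; apply: leq_trans (dist_ecc k v).
  apply: (@dist_sep P); rewrite ?(outer_neq kB) ?(inner_neq vA) //.
  by rewrite top_outer // top_inner // (negbTE Pv) Pk.
have ecc_outer w : w \in outer -> 4 <= ecc w.
  move=> wB; have [Pw|Pw] := boolP (P (par w)).
    apply: leq_trans (dist_ecc r w); rewrite dist_sym //.
    by apply: split_far => //; rewrite inE wB.
  by apply: leq_trans (dist_ecc k w); apply: split_far => //; rewrite inE wB.
have : 2 * dist_sum c + 3 * \sum_(v in inner) dist_sum v
        + 4 * \sum_(v in outer) dist_sum v <= eds G.
  rewrite /eds sum_hub -!sum_mulr_in; apply: leq_add; first apply: leq_add.
  - by rewrite leq_mul2r ecc_c orbT.
  - by apply: leq_sum => v vA; rewrite leq_mul2r ecc_inner ?orbT.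
  - by apply: leq_sum => v vA; rewrite leq_mul2r ecc_outer ?orbT.
rewrite dist_sum_hub dist_sum_inner dist_sum_outer; lia.
Qed.

End Split.

End Hub.

(** * Recognizing a graph from its parent function *)

(* [N] lists the vertices that are not mere leaves at the hub, the hub coming
   first and the ends of the extra edge next; the parent of its i-th member is
   its [m]_i-th member. *)
Record hub_shape (m : seq nat) (G : sgraph) (c : G) (par : G -> G) (N : seq G) :
    Prop := HubShape {
  shape_hub : hubbed c par (nth c N 1) (nth c N 2);
  shape_uniq : uniq N;
  shape_c : nth c N 0 = c;
  shape_par : map par N = map (nth c N) m;
  shape_rest : forall x, x \notin N -> par x = c }.

Lemma card_enum_cat (T : finType) (N : seq T) : uniq N ->
  let l := N ++ [seq x <- enum T | x \notin N] in
  [/\ uniq l, size l = #|T| & forall x, x \in l].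
Proof.
move=> uN l; have ul : uniq l.
  rewrite cat_uniq uN filter_uniq ?enum_uniq // andbT.
  by apply/hasPn => x; rewrite mem_filter => /andP[].
have all_l x : x \in l.
  by rewrite mem_cat mem_filter mem_enum andbT orbN.
split=> //; rewrite -(card_uniqP ul); apply: eq_card => x; exact: all_l.
Qed.

(** Completing both lists by the remaining vertices in any order and matching positions gives a
    bijection that commutes with the parent functions and preserves [c], s and t; by [hub_adj] these
    determine adjacency. *)
Lemma shape_iso m (G H : sgraph) c par N c' par' N' :
  @hub_shape m G c par N -> @hub_shape m H c' par' N' -> #|G| = #|H| -> iso G H.
Proof.
case=> hubG uN Nc parN restN [hubH uN' Nc' parN' restN'] cardGH.
have sN : size N = size m by rewrite -(size_map par) parN size_map.
have sN' : size N' = size m by rewrite -(size_map par') parN' size_map.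
have [ul sl all_l] := card_enum_cat uN.
have [ul' sl' all_l'] := card_enum_cat uN'.
set l := N ++ _ in ul sl all_l; set l' := N' ++ _ in ul' sl' all_l'.
pose f x := nth c' l' (index x l); pose g y := nth c l (index y l').
have lt_l x : index x l < size l' by rewrite sl' -cardGH -sl index_mem.
have lt_l' y : index y l' < size l by rewrite sl cardGH -sl' index_mem.
have fK : cancel f g by move=> x; rewrite /g /f index_uniq // nth_index.
have gK : cancel g f by move=> y; rewrite /g /f index_uniq // nth_index.
have inj_f := can_inj fK.
have fN i : i < size m -> f (nth c N i) = nth c' N' i.
  move=> lt_i; rewrite /f index_cat mem_nth ?sN // index_uniq ?sN //.
  by rewrite nth_cat sN' lt_i.
(* With an empty list, s and t would both be the default [c]. *)
have m_gt0 : 0 < size m.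
  case: (posnP (size m)) => // m0; have := hub_st hubG.
  by rewrite !nth_default ?sN ?m0 // eqxx.
have fc : f c = c' by rewrite -Nc fN.
have fN' i : f (nth c N i) = nth c' N' i.
  have [|le_m] := ltnP i (size m); first exact: fN.
  by rewrite !nth_default ?sN ?sN'.
have f_par x : f (par x) = par' (f x).
  have [xN|xN] := boolP (x \in N).
    rewrite -(nth_index c xN) fN'; have lt_x : index x N < size m.
      by rewrite -sN index_mem.
    rewrite -(nth_map c c par) ?sN // parN -(nth_map c' c' par') ?sN' // parN'.
    by rewrite !(nth_map 0) // fN'.
  rewrite restN // fc restN' //; apply: contra xN => fxN'.
  have lt_x : index (f x) N' < size m by rewrite -sN' index_mem.
  rewrite -(fK x) -(nth_index c' fxN') -fN // fK; apply: mem_nth.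
  by rewrite sN.
exists f; first by exists g.
move=> x y; rewrite (hub_adj hubG) (hub_adj hubH) -!fN' -fc -!f_par.
by rewrite !(inj_eq inj_f).
Qed.

(** * Adjacency, leaf distances and covers in the rooted graph *)

Section Cases.

Variables (G : sgraph) (c : G) (par : G -> G) (s t : G).
Hypotheses (connG : connected G) (hubG : hubbed c par s t).
Implicit Types (x y z u v w : G).

Local Notation inner := (inner c par).
Local Notation outer := (outer c par).
Local Notation top := (top c par).
Local Notation a := #|inner|.
Local Notation b := #|outer|.

Definition ends x y := (x == s) && (y == t) || (x == t) && (y == s).

Lemma adj_inner u v : u \in inner -> v \in inner -> adj u v = ends u v.
Proof.
rewrite !inE (hub_adj hubG) => /andP[uc /eqP->] /andP[vc /eqP->].
by rewrite ![c == _]eq_sym (negbTE uc) (negbTE vc) !andbF.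
Qed.

Lemma adj_outer u v : u \in outer -> v \in outer -> adj u v = ends u v.
Proof.
move=> uB vB; have [pu pv] := (par_inner hubG uB, par_inner hubG vB).
rewrite (hub_adj hubG) (negbTE (inner_outer pu vB)).
by rewrite (negbTE (inner_outer pv uB)) !andbF.
Qed.

Lemma adj_outer_inner w v : w \in outer -> v \in inner ->
  adj w v = (par w == v) || ends w v.
Proof.
move=> wB vA; rewrite (hub_adj hubG) (outer_neq hubG wB) /=.
move: vA (outer_neq hubG wB); rewrite !inE => /andP[-> /eqP->].
by rewrite [c == w]eq_sym => /negbTE->.
Qed.

Lemma adj_leaf w z : w \in outer -> w != s -> w != t -> adj w z -> z = par w.
Proof.
move=> wB /negbTE ws /negbTE wt; rewrite (hub_adj hubG) ws wt !orbF.
case/orP=> /andP[zc /eqP] // E.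
by move: wB; rewrite inE -E (par_par hubG) eqxx.
Qed.

Lemma dist_leaf k w y : w \in outer -> w != s -> w != t -> w != y ->
  k <= dist (par w) y -> k < dist w y.
Proof.
move=> wB ws wt wy le_k; apply: dist_gt => // z wz.
by rewrite (adj_leaf wB ws wt wz).
Qed.

Lemma dist_outer_inner_gt1 v w : v \in inner -> w \in outer ->
  v != par w -> ~~ ends w v -> 1 < dist w v.
Proof.
move=> vA wB vpw Nst; apply: dist_gt1 => //.
  by rewrite eq_sym (inner_outer vA wB).
by rewrite adj_outer_inner // eq_sym (negbTE vpw).
Qed.

Lemma dist_leaf_inner v w : v \in inner -> w \in outer -> w != s -> w != t ->
  v != par w -> ~~ ends (par w) v -> 2 < dist w v.
Proof.
move=> vA wB ws wt vpw Nst; apply: dist_leaf => //.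
  by rewrite eq_sym (inner_outer vA wB).
have pA := par_inner hubG wB; apply: dist_gt1 => //; first by rewrite eq_sym.
by rewrite adj_inner.
Qed.

Lemma dist_end_inner v : v \in inner -> t \in outer ->
  v != par t -> v != top s -> 2 < dist t v.
Proof.
move=> vA tB vpt vts; rewrite -[3]/(2 + 1).
rewrite -{1}(depth_outer hubG tB) -(depth_inner vA).
apply: (dist_branch connG hubG).
- exact: (outer_neq hubG).
- exact: (inner_neq vA).
- by rewrite top_outer // top_inner // eq_sym.
- by rewrite (top_inner vA) (top_outer tB) (negbTE vpt) andbF.
- by rewrite (top_inner vA) (negbTE vts) andbF.
Qed.

Lemma sum_ends (S : {set G}) :
  (forall u v, u \in S -> v \in S -> adj u v = ends u v) ->
  \sum_(v in S) \sum_(u in S) adj u v <= 2 * ((s \in S) && (t \in S)).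
Proof.
move=> adjE; apply: (@leq_trans (\sum_(v in S) \sum_(u in S)
    ((v == t) * (u == s) + (v == s) * (u == t)))).
  apply: leq_sum => v vS; apply: leq_sum => u uS; rewrite adjE // /ends.
  by case: (v == t); case: (u == s); case: (v == s); case: (u == t).
rewrite (eq_bigr (fun v => (v == t) * (s \in S) + (v == s) * (t \in S))).
  rewrite sum_add_in !sum_mull_in !sum_eq_in.
  by case: (s \in S); case: (t \in S).
by move=> v vS; rewrite !(sum_mulr_in, sum_add_in) !sum_eq_in.
Qed.

(** If an end of s-t were [x] or [y], then [c], [x], [y] would cover every edge: a tree edge
    contains the hub, or it joins an outer vertex to its parent. *)
Lemma matching_cover (x y : G) : 3 < matching_number G ->
  (forall w, w \in outer -> [|| w == x, w == y, par w == x | par w == y]) ->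
  ~~ [|| s == x, s == y, t == x | t == y].
Proof.
move=> m4 covB; apply/negP => cov_st; move: m4; rewrite ltnNge => /negP; apply.
apply: (@leq_trans #|[set c; x; y]|).
  apply: matching_number_cover => u v; rewrite (hub_adj hubG) !inE.
  have tree z z' : (z != c) && (par z == z') ->
    (z == c) || (z == x) || (z == y) || ((z' == c) || (z' == x) || (z' == y)).
    move=> /andP[zc /eqP <-]; have [zB|] := boolP (z \in outer).
      by case/or4P: (covB z zB) => ->; rewrite ?orbT.
    by rewrite inE negbK => ->; rewrite ?orbT.
  case/or4P.
  - exact: tree.
  - by move/tree; rewrite orbC.
  - by case/andP=> /eqP-> /eqP->; case/or4P: cov_st => ->; rewrite ?orbT.
  - by case/andP=> /eqP-> /eqP->; case/or4P: cov_st => ->; rewrite ?orbT.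
rewrite (leq_trans (leq_card_setU _ _)) // cards1 addn1 ltnS.
by rewrite (leq_trans (leq_card_setU _ _)) // !cards1.
Qed.

End Cases.

(** * Lower bounds, by position of the extra edge *)

(** The two admissible totals of the weighted defects are 22, reached when a 5-cycle passes through
    the hub, and 6 + 7k, for a triangle at the hub with k outer vertices hanging from s or t. *)
Lemma far_count a b k r e al be ga :
  2 <= a -> 0 < k -> 0 < r -> k + r = b -> 4 <= b ->
  (3 * al + 7 * be + 4 * ga <= 22) || (3 * al + 7 * be + 4 * ga <= 6 + 7 * k) ->
  6 * a ^ 2 + 21 * a * b + 8 * b ^ 2 + 16 * k * r
    <= e + a + 10 * b + 3 * al + 7 * be + 4 * ga ->
  6 * (1 + a + b) ^ 2 + 17 * (1 + a + b) < e + 147.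
Proof.
move=> a2 k0 r0 krb b4 dP bound; move: bound dP.
rewrite -[e + a + 10 * b + _ + _]addnA -[leqRHS]addnA.
move: (3 * al + 7 * be + 4 * ga) => d bound dP.
have ab : 4 * a <= a * b by rewrite mulnC leq_mul2l b4 orbT.
have b7 : 15 * b <= b * b + 56.
  by clear; have [|] := leqP b 7; nia.
have k_kr : k <= k * r by rewrite leq_pmulr.
have kr : b <= k * r + 1.
  by clear -k0 r0 krb; case: k r k0 r0 krb => // k [|r] // _ _ <-; lia.
rewrite -!mulnn in bound *; rewrite -[16 * k * r]mulnA in bound.
move: (k * r) k_kr kr bound => m k_kr kr bound.
by case/orP: dP => dP; clear -a2 b4 b7 ab k_kr kr dP bound; lia.
Qed.

(** For three outer vertices k * r = 2, and the bound exceeds [6n^2 + 14n - 100] by exactly 22 minus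
    the weighted defects: below 22 the inequality is strict. *)
Lemma near_count a k r e al be ga : 0 < k -> 0 < r -> k + r = 3 ->
  6 * a ^ 2 + 21 * a * 3 + 8 * 3 ^ 2 + 16 * k * r
    <= e + a + 10 * 3 + 3 * al + 7 * be + 4 * ga ->
  6 * (1 + a + 3) ^ 2 + 14 * (1 + a + 3) + 22 <= e + 100 + (3 * al + 7 * be + 4 * ga).
Proof.
move=> k0 r0 kr; have kr2 : k * r = 2.
  have [[-> ->]//|[-> ->]//] : (k = 1 /\ r = 2) \/ (k = 2 /\ r = 1) by lia.
have -> : 16 * k * r = 32 by rewrite -mulnA kr2.
lia.
Qed.

Lemma near_count_lt a k r e al be ga : 0 < k -> 0 < r -> k + r = 3 ->
  (3 * al + 7 * be + 4 * ga <= 21) || (3 * al + 7 * be + 4 * ga <= 6 + 7 * k) ->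
  6 * a ^ 2 + 21 * a * 3 + 8 * 3 ^ 2 + 16 * k * r
    <= e + a + 10 * 3 + 3 * al + 7 * be + 4 * ga ->
  6 * (1 + a + 3) ^ 2 + 14 * (1 + a + 3) < e + 100.
Proof. by move=> k0 r0 kr dP /(near_count k0 r0 kr); lia. Qed.

Lemma small_sum k r b : 0 < k -> 0 < r -> k + r = b -> b < 4 -> b = 2 \/ b = 3.
Proof. lia. Qed.

Lemma large_sum k r b : 1 < k -> 0 < r -> k + r = b -> b < 4 -> b = 3.
Proof. lia. Qed.

Lemma ge3_par d k : 0 < d -> 3 <= d + 2 * true + k.
Proof. lia. Qed.

Lemma ge3_two d j : 0 < d -> 3 <= d + j + 2 * true.
Proof. lia. Qed.

Lemma ge3_far d j k : 2 < d -> 3 <= d + j + k.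
Proof. lia. Qed.

Lemma ge3_end d j k : 1 < d -> 0 < k -> 3 <= d + j + k.
Proof. lia. Qed.

(** Either alternative suffices, as it puts [eds G] above the smaller of the two extremal values. *)
Definition eds_strict (G : sgraph) := 6 * #|G| ^ 2 + 17 * #|G| < eds G + 147
  \/ 6 * #|G| ^ 2 + 14 * #|G| < eds G + 100.

Section Split.

Variables (G : sgraph) (c : G) (par : G -> G).
Implicit Types (u v w : G).

Local Notation outer := (outer c par).
Local Notation b := #|outer|.

Lemma split_card (P : pred G) :
  #|[set w in outer | P (par w)]| + #|[set w in outer | ~~ P (par w)]| = b.
Proof.
rewrite -(cardsID [set w | P (par w)] outer); congr (_ + _).
  by apply: eq_card => w; rewrite !inE.
by apply: eq_card => w; rewrite !inE andbC.
Qed.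

Lemma split_rest (P : pred G) :
  (forall w, w \in outer -> P (par w)) \/ 0 < #|[set w in outer | ~~ P (par w)]|.
Proof.
have [|/set0Pn[w wR]] := eqVneq [set w in outer | ~~ P (par w)] set0.
  move=> R0; left=> w wB; apply: contraT => NP.
  by have := in_set0 w; rewrite -R0 inE wB NP.
by right; apply/card_gt0P; exists w.
Qed.

Lemma sum_zero (S S' : {set G}) : \sum_(v in S) \sum_(u in S') 0 <= 0.
Proof. by rewrite big1 // => v _; rewrite big1. Qed.

Lemma split_two (P : pred G) : b = 2 ->
  0 < #|[set w in outer | P (par w)]| -> 0 < #|[set w in outer | ~~ P (par w)]| ->
  exists w1 w2, [/\ outer = [set w1; w2], w1 != w2, P (par w1) & ~~ P (par w2)].
Proof.
move=> b2 K0 R0; have := split_card P; rewrite b2 => KR.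
have /cards1P[w1 K1] : #|[set w in outer | P (par w)]| == 1 by apply/eqP; lia.
have /cards1P[w2 R1] : #|[set w in outer | ~~ P (par w)]| == 1 by apply/eqP; lia.
have /setIdP[w1B P1] : w1 \in [set w in outer | P (par w)] by rewrite K1 inE.
have /setIdP[w2B P2] : w2 \in [set w in outer | ~~ P (par w)] by rewrite R1 inE.
have neq : w1 != w2 by apply: contraTneq P1 => ->.
exists w1, w2; split=> //; apply/esym/eqP; rewrite eqEcard cards2 neq b2 andbT.
by apply/subsetP => w; rewrite in_set2 => /orP[]/eqP->.
Qed.

End Split.

(** Positions 0, 1, 2 hold the hub and the ends s, t. In [U4_code], 3 and 4 are the ends of the
    pendant paths and 5 and 6 their middles. In [U4'_code], s and t hang from 4 and 5, and 3 ends
    the path through 6. In [C5_1_code], s and 3 hang from 5, t and 4 from 6. *)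
Definition U4_code := [:: 0; 0; 0; 5; 6; 0; 0].
Definition U4'_code := [:: 0; 4; 5; 6; 0; 0; 0].
Definition C5_1_code := [:: 0; 5; 6; 5; 6; 0; 0].

(** * The extra edge closes a triangle at the hub *)

Section Cases.

Variables (G : sgraph) (c : G) (par : G -> G) (s t : G).
Hypotheses (connG : connected G) (hubG : hubbed c par s t).
Hypothesis matchG : 3 < matching_number G.
Implicit Types (x y z u v w : G).

Local Notation inner := (inner c par).
Local Notation outer := (outer c par).
Local Notation top := (top c par).
Local Notation a := #|inner|.
Local Notation b := #|outer|.

Lemma eds_inner_inner : s \in inner -> t \in inner ->
  eds_strict G \/ exists N, hub_shape U4_code c par N.
Proof.
move=> sA tA; have [Ts Tt] := (top_inner sA, top_inner tA).
have nG : #|G| = 1 + a + b := card_hub hubG.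
have a2 : 2 <= a.
  have := subset_leq_card (_ : [set s; t] \subset inner).
  rewrite cards2 (hub_st hubG); apply.
  by apply/subsetP => x; rewrite in_set2 => /orP[]/eqP->.
have neq_st w : w \in outer -> w != s /\ w != t.
  by move=> wB; rewrite ![w == _]eq_sym !(inner_outer _ wB).
have sB : s \notin outer by apply/negP => /(neq_st s)[]; rewrite eqxx.
have [w0 w0B|outer0] := pickP (mem outer); last first.
  have := matching_cover (x := s) (y := s) hubG matchG.
  by rewrite eqxx => /(_ _)/negP[] // w; have := outer0 w => /= ->.
have [w /= /andP[wB pw]|none] := pickP [pred w in outer | (par w == s) || (par w == t)].
  left; pose P := pred2 s t.
  have Pst : P (top s) = P (top t) by rewrite Ts Tt /= !eqxx orbT.
  have K0 : 0 < #|[set w in outer | P (par w)]|.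
    by apply/card_gt0P; exists w; rewrite inE wB.
  have [allP|R0] := split_rest c par P.
    have := matching_cover (x := s) (y := t) hubG matchG.
    rewrite eqxx => /(_ _)/negP[] // u /allP /=.
    by case/orP=> ->; rewrite !orbT.
  (* A child of s reaches t in 2 steps instead of 3, and symmetrically: one defect per outer vertex
     in the class of s and t. *)
  pose e v w : nat := (v == s) * (par w == t) + (v == t) * (par w == s).
  have ge3 v u : v \in inner -> u \in outer ->
      3 <= dist u v + 2 * (v == par u) + e v u.
    move=> vA uB; have [us ut] := neq_st u uB.
    have [E|neq] := eqVneq v (par u).
      by apply: ge3_par; rewrite dist_gt0 // eq_sym (inner_outer vA uB).
    have [E|NE] := boolP (ends s t (par u) v); last first.
      exact: ge3_far (dist_leaf_inner connG hubG vA uB us ut neq NE).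
    apply: ge3_end.
      apply: (dist_outer_inner_gt1 connG hubG) => //.
      by rewrite /ends (negbTE us) (negbTE ut).
    by rewrite /e; case/orP: E => /andP[/eqP-> /eqP->]; rewrite !eqxx ?addn_gt0 ?orbT.
  have be : \sum_(v in inner) \sum_(w in outer) e v w
            <= #|[set w in outer | P (par w)]|.
    rewrite exchange_big /= -sum_mem_in; apply: leq_sum => u _ /=.
    rewrite !(sum_mull_in, sum_add_in) !sum_eq_in sA tA /=.
    have [->|_] := eqVneq (par u) s; last by case: eqP.
    by rewrite (negbTE (hub_st hubG)).
  have al := sum_ends (@adj_inner _ _ _ _ _ hubG).
  have ga := sum_ends (@adj_outer _ _ _ _ _ hubG).
  rewrite sA tA muln1 in al.
  rewrite (negbTE sB) muln0 in ga.
  have := eds_split connG hubG Pst K0 R0 al ge3 be ga.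
  have := split_card c par P; set k := #|_| in K0 *; set r := #|_| in R0 *.
  move=> kr bound; have [b_ge4|b_lt4] := leqP 4 b.
    left; rewrite nG; apply: far_count a2 K0 R0 kr b_ge4 _ bound.
    by rewrite muln0 addn0 leqnn orbT.
  have [b2|b3] := small_sum K0 R0 kr b_lt4.
    (* The hub and the parents of the two outer vertices cover all edges, one of these parents being
       s or t. *)
    have [w1 [w2 [defB _ /= P1 _]]] := split_two b2 K0 R0.
    have := matching_cover (x := par w1) (y := par w2) hubG matchG.
    rewrite ![s == _]eq_sym ![t == _]eq_sym.
    case/orP: P1 => ->; rewrite ?orbT => /(_ _)/negP[] // u;
    by rewrite defB in_set2 => /orP[]/eqP->; rewrite eqxx !orbT.
  right; rewrite nG b3 in bound kr *; apply: near_count_lt K0 R0 kr _ bound.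
  by rewrite muln0 addn0 leqnn orbT.
(* No outer vertex hangs from s or t now, so a single branch splits off without defect in [dAB]. If
   it contained all outer vertices, then [c], [par w0] and s would be a cover. *)
pose P := pred1 (par w0).
have Npar w : w \in outer -> par w != s /\ par w != t.
  by move=> wB; have := none w; rewrite /= wB /= => /norP.
have Pst : P (top s) = P (top t).
  by rewrite Ts Tt /= ![_ == par w0]eq_sym; have [/negbTE-> /negbTE->] := Npar w0 w0B.
have K0 : 0 < #|[set w in outer | P (par w)]|.
  by apply/card_gt0P; exists w0; rewrite inE [w0 \in _]w0B /= eqxx.
have [allP|R0] := split_rest c par P.
  have := matching_cover (x := par w0) (y := s) hubG matchG.
  by rewrite eqxx orbT => /(_ _)/negP[] // u /allP /= ->; rewrite !orbT.
have ge3 v u : v \in inner -> u \in outer -> 3 <= dist u v + 2 * (v == par u) + 0.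
  move=> vA uB; have [us ut] := neq_st u uB; have [ps pt] := Npar u uB.
  have [E|neq] := eqVneq v (par u).
    by apply: ge3_par; rewrite dist_gt0 // eq_sym (inner_outer vA uB).
  have NE : ~~ ends s t (par u) v by rewrite /ends (negbTE ps) (negbTE pt).
  exact: ge3_far (dist_leaf_inner connG hubG vA uB us ut neq NE).
have al := sum_ends (@adj_inner _ _ _ _ _ hubG).
have ga := sum_ends (@adj_outer _ _ _ _ _ hubG).
rewrite sA tA muln1 in al.
rewrite (negbTE sB) muln0 in ga.
have := eds_split connG hubG Pst K0 R0 al ge3 (sum_zero _ _) ga.
have := split_card c par P; move=> kr bound; have [b_ge4|b_lt4] := leqP 4 b.
  left; left; rewrite nG; apply: far_count a2 K0 R0 kr b_ge4 _ bound.
  by [].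
have [b2|b3] := small_sum K0 R0 kr b_lt4.
  have [w1 [w2 [defB neq12 /= P1 P2]]] := split_two b2 K0 R0.
  (* Two outer vertices in different branches, both apart from the triangle, are the ends of the two
     pendant paths of [U4]. *)
  right; exists [:: c; s; t; w1; w2; par w1; par w2].
  have w1B : w1 \in outer by rewrite defB set21.
  have w2B : w2 \in outer by rewrite defB set22.
  have [p1A p2A] := (par_inner hubG w1B, par_inner hubG w2B).
  have [n1s n1t] := Npar w1 w1B; have [n2s n2t] := Npar w2 w2B.
  have npp : par w1 != par w2 by rewrite (eqP P1) eq_sym.
  split=> //=.
  - rewrite !inE !negb_or ![c == _]eq_sym ![s == par _]eq_sym ![t == par _]eq_sym.
    rewrite (hub_s hubG) (hub_t hubG) (hub_st hubG) (outer_neq hubG w1B).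
    rewrite (outer_neq hubG w2B) (inner_neq p1A) (inner_neq p2A).
    rewrite neq12 npp n1s n1t n2s n2t.
    rewrite (inner_outer sA w1B) (inner_outer sA w2B).
    rewrite (inner_outer tA w1B) (inner_outer tA w2B).
    rewrite ![w1 == par _]eq_sym ![w2 == par _]eq_sym.
    rewrite (inner_outer p1A w1B) (inner_outer p1A w2B).
    by rewrite (inner_outer p2A w1B) (inner_outer p2A w2B).
  - rewrite !(par_par hubG) (par_hub hubG).
    by move: sA tA; rewrite !inE => /andP[_ /eqP->] /andP[_ /eqP->].
  move=> x; apply: contraNeq => px.
  have : x \in outer by rewrite inE.
  by rewrite defB !inE => /orP[]->; rewrite !orbT.
by left; right; rewrite nG b3 in bound kr *; apply: near_count_lt K0 R0 kr _ bound.
Qed.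

End Cases.

(** * The extra edge closes a 4-cycle, a triangle away from the hub, or a 5-cycle *)

Section Cases.

Variables (G : sgraph) (c : G) (par : G -> G) (s t : G).
Hypotheses (connG : connected G) (hubG : hubbed c par s t).
Hypothesis matchG : 3 < matching_number G.
Implicit Types (x y z u v w : G).

Local Notation inner := (inner c par).
Local Notation outer := (outer c par).
Local Notation top := (top c par).
Local Notation a := #|inner|.
Local Notation b := #|outer|.

Lemma two_inner w w' : w \in outer -> w' \in outer -> par w != par w' -> 2 <= a.
Proof.
move=> wB w'B neq; have := subset_leq_card (_ : [set par w; par w'] \subset inner).
rewrite cards2 neq; apply; apply/subsetP => x.
by rewrite in_set2 => /orP[]/eqP->; apply: (par_inner hubG).
Qed.

Lemma eds_inner_outer : s \in inner -> t \in outer -> eds_strict G.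
Proof.
move=> sA tB; have [Ts Tt] := (top_inner sA, top_outer tB).
have nG : #|G| = 1 + a + b := card_hub hubG.
have neq_s w : w \in outer -> w != s.
  by move=> wB; rewrite eq_sym (inner_outer sA wB).
have spt : s != par t by rewrite eq_sym (hub_pts hubG).
have ptA := par_inner hubG tB.
have tA v : v \in inner -> v != t by move=> vA; apply: inner_outer vA tB.
have sB : s \notin outer by apply/negP => /(neq_s s); rewrite eqxx.
have tNA : t \notin inner by apply/negP => /tA; rewrite eqxx.
pose P := pred2 s (par t).
have Pst : P (top s) = P (top t) by rewrite Ts Tt /= !eqxx orbT.
have K0 : 0 < #|[set w in outer | P (par w)]|.
  by apply/card_gt0P; exists t; rewrite inE tB /= eqxx orbT.
have [allP|R0] := split_rest c par P.
  have := matching_cover (x := s) (y := par t) hubG matchG.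
  rewrite eqxx => /(_ _)/negP[] // u /allP /=.
  by case/orP=> ->; rewrite !orbT.
(* On the 4-cycle through [c], s, t and [par t], only the pair s, t is shortened, from 3 to 1. *)
pose e v w : nat := 2 * ((v == s) * (w == t)).
have ge3 v u : v \in inner -> u \in outer ->
    3 <= dist u v + 2 * (v == par u) + e v u.
  move=> vA uB; have us := neq_s u uB.
  have d0 : 0 < dist u v by rewrite dist_gt0 // eq_sym (inner_outer vA uB).
  have [E|neq] := eqVneq v (par u); first exact: ge3_par.
  have [ut|ut] := eqVneq u t.
    rewrite /e ut eqxx muln1 in d0 neq *.
    have [_|vs] := eqVneq v s; first exact: ge3_two.
    by apply: ge3_far; apply: (dist_end_inner connG hubG) => //; rewrite Ts.
  apply: ge3_far; apply: (dist_leaf_inner connG hubG) => //.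
  rewrite /ends negb_or !negb_and (tA v vA) orbT.
  by rewrite (tA _ (par_inner hubG uB)).
have be : \sum_(v in inner) \sum_(w in outer) e v w <= 2.
  rewrite (eq_bigr (fun v => 2 * (v == s))) => [|v vA].
    by rewrite sum_mulr_in sum_eq_in sA.
  by rewrite !sum_mulr_in sum_eq_in tB muln1.
have al := sum_ends (@adj_inner _ _ _ _ _ hubG).
have ga := sum_ends (@adj_outer _ _ _ _ _ hubG).
rewrite (negbTE sB) muln0 in ga; rewrite (negbTE tNA) andbF muln0 in al.
have := eds_split connG hubG Pst K0 R0 al ge3 be ga.
have a2 : 2 <= a.
  have /card_gt0P[w /setIdP[wB /norP[/= _ neq]]] := R0.
  exact: two_inner wB tB neq.
have := split_card c par P; move=> kr bound; have [b_ge4|b_lt4] := leqP 4 b.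
  by left; rewrite nG; apply: far_count a2 K0 R0 kr b_ge4 _ bound.
have [b2|b3] := small_sum K0 R0 kr b_lt4.
  have [w1 [w2 [defB _ /= P1 P2]]] := split_two b2 K0 R0.
  (* Here t is one of the two outer vertices, and it also covers the extra edge. *)
  have := matching_cover (x := t) (y := par w2) hubG matchG.
  rewrite eqxx !orbT => /(_ _)/negP[] // u.
  have -> : outer = [set t; w2].
    move: (tB); rewrite defB in_set2 => /orP[/eqP->//|/eqP tw].
    by move: P2; rewrite -tw eqxx orbT.
  by rewrite in_set2 => /orP[]/eqP->; rewrite eqxx ?orbT.
by right; rewrite nG b3 in bound kr *; apply: near_count_lt K0 R0 kr _ bound.
Qed.

(** The triangle lies inside one branch and shortens no inner-outer distance. That branch contains
    both s and t and, by the cover [c], [par s], s, some outer vertex lies elsewhere, whence b >=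
    3. *)
Lemma eds_siblings : s \in outer -> t \in outer -> par s = par t -> eds_strict G.
Proof.
move=> sB tB pst; have [Ts Tt] := (top_outer sB, top_outer tB).
have nG : #|G| = 1 + a + b := card_hub hubG.
have NA v : v \in inner -> v != s /\ v != t.
  by move=> vA; rewrite (inner_outer vA sB) (inner_outer vA tB).
have sNA : s \notin inner by apply/negP => /NA[]; rewrite eqxx.
pose P := pred1 (par s).
have Pst : P (top s) = P (top t) by rewrite Ts Tt pst.
have K2 : 1 < #|[set w in outer | P (par w)]|.
  have := subset_leq_card (_ : [set s; t] \subset [set w in outer | P (par w)]).
  rewrite cards2 (hub_st hubG); apply; apply/subsetP => x.
  by rewrite in_set2 => /orP[]/eqP->; rewrite inE ?sB ?tB /= ?pst eqxx.
have K0 := ltnW K2.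
have [allP|R0] := split_rest c par P.
  have := matching_cover (x := par s) (y := s) hubG matchG.
  by rewrite eqxx orbT => /(_ _)/negP[] // u /allP /= ->; rewrite !orbT.
have ge3 v u : v \in inner -> u \in outer -> 3 <= dist u v + 2 * (v == par u) + 0.
  move=> vA uB; have [vs vt] := NA v vA.
  have [E|neq] := eqVneq v (par u).
    by apply: ge3_par; rewrite dist_gt0 // eq_sym (inner_outer vA uB).
  rewrite !addn0 -[3]/(2 + 1) -{1}(depth_outer hubG uB) -(depth_inner vA).
  have Tu := top_outer uB; have Tv := top_inner vA.
  have Nsame : ~~ ((par u == par s) && (v == par s)).
    by apply: contra neq => /andP[/eqP-> /eqP->].
  apply: (dist_branch connG hubG); rewrite ?Tu ?Tv ?Ts ?Tt -?pst //.
  - exact: (outer_neq hubG uB).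
  - exact: (inner_neq vA).
  - by rewrite eq_sym.
have al := sum_ends (@adj_inner _ _ _ _ _ hubG).
have ga := sum_ends (@adj_outer _ _ _ _ _ hubG).
rewrite (negbTE sNA) muln0 in al; rewrite sB tB muln1 in ga.
have := eds_split connG hubG Pst K0 R0 al ge3 (sum_zero _ _) ga.
have a2 : 2 <= a.
  have /card_gt0P[w /setIdP[wB /= neq]] := R0.
  exact: two_inner wB sB neq.
have := split_card c par P; move=> kr bound; have [b_ge4|b_lt4] := leqP 4 b.
  by left; rewrite nG; apply: far_count a2 K0 R0 kr b_ge4 _ bound.
have b3 : b = 3 := large_sum K2 R0 kr b_lt4.
by right; rewrite nG b3 in bound kr *; apply: near_count_lt K0 R0 kr _ bound.
Qed.

(** The 5-cycle shortens only the two distances from s to [par t] and from t to [par s], from 3 to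
    2. *)
Lemma dist_outer_inner_C5 v u : s \in outer -> t \in outer -> par s != par t ->
  v \in inner -> u \in outer ->
  3 <= dist u v + 2 * (v == par u)
         + ((v == par t) * (u == s) + (v == par s) * (u == t)).
Proof.
move=> sB tB pst vA uB; have [vs vt] := (inner_outer vA sB, inner_outer vA tB).
have d0 : 0 < dist u v by rewrite dist_gt0 // eq_sym (inner_outer vA uB).
have [E|neq] := eqVneq v (par u); first exact: ge3_par.
have Nend x : ~~ ends s t x v.
  by rewrite /ends (negbTE vs) (negbTE vt) !andbF.
have d1 := dist_outer_inner_gt1 connG hubG vA uB neq (Nend u).
have [us|us] := eqVneq u s.
  have [_|vpt] := eqVneq v (par t); first exact: ge3_end.
  apply: ge3_far; rewrite us; rewrite us in neq.
  by apply: (dist_end_inner connG (hubbed_sym hubG)) => //; rewrite top_outer.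
have [ut|ut] := eqVneq u t.
  have [_|vps] := eqVneq v (par s); first by apply: ge3_end; rewrite // addn_gt0 orbT.
  apply: ge3_far; rewrite ut; rewrite ut in neq.
  by apply: (dist_end_inner connG hubG) => //; rewrite top_outer.
exact: ge3_far (dist_leaf_inner connG hubG vA uB us ut neq (Nend _)).
Qed.

Lemma sum_C5 : s \in outer -> t \in outer ->
  \sum_(v in inner) \sum_(u in outer)
    ((v == par t) * (u == s) + (v == par s) * (u == t)) <= 2.
Proof.
move=> sB tB.
rewrite (eq_bigr (fun v => (v == par t) + (v == par s))) => [|v vA].
  by rewrite sum_add_in !sum_eq_in !(par_inner hubG).
by rewrite !(sum_mulr_in, sum_add_in) !sum_eq_in sB tB !muln1.
Qed.

(** The weighted defects are 7 * 2 + 4 * 2 = 22, all that [near_count] tolerates. For b = 3 the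
    outer vertices are exactly s, t and [w0], which is the shape of [U4']. *)
Lemma eds_C5_branch w0 : s \in outer -> t \in outer -> par s != par t ->
  w0 \in outer -> par w0 != par s -> par w0 != par t ->
  eds_strict G \/
  (exists N, hub_shape U4'_code c par N) /\ 6 * #|G| ^ 2 + 14 * #|G| <= eds G + 100.
Proof.
move=> sB tB pst wB ws wt; have [Ts Tt] := (top_outer sB, top_outer tB).
have nG : #|G| = 1 + a + b := card_hub hubG.
have sNA : s \notin inner by apply/negP => /inner_outer/(_ sB); rewrite eqxx.
pose P := pred2 (par s) (par t).
have Pst : P (top s) = P (top t) by rewrite Ts Tt /= !eqxx orbT.
have K2 : 1 < #|[set w in outer | P (par w)]|.
  have := subset_leq_card (_ : [set s; t] \subset [set w in outer | P (par w)]).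
  rewrite cards2 (hub_st hubG); apply; apply/subsetP => x.
  by rewrite in_set2 => /orP[]/eqP->; rewrite inE ?sB ?tB /= eqxx ?orbT.
have K0 := ltnW K2.
have R0 : 0 < #|[set w in outer | ~~ P (par w)]|.
  by apply/card_gt0P; exists w0; rewrite inE wB /= negb_or ws wt.
have ge3 := dist_outer_inner_C5 sB tB pst.
have al := sum_ends (@adj_inner _ _ _ _ _ hubG).
have ga := sum_ends (@adj_outer _ _ _ _ _ hubG).
rewrite (negbTE sNA) muln0 in al; rewrite sB tB muln1 in ga.
have := eds_split connG hubG Pst K0 R0 al ge3 (sum_C5 sB tB) ga.
have a2 := two_inner sB tB pst.
have := split_card c par P; move=> kr bound; have [b_ge4|b_lt4] := leqP 4 b.
  by left; left; rewrite nG; apply: far_count a2 K0 R0 kr b_ge4 _ bound.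
have b3 : b = 3 := large_sum K2 R0 kr b_lt4.
right; split; last first.
  rewrite nG b3 in bound kr *; have := near_count K0 R0 kr bound.
  by rewrite leq_add2r.
exists [:: c; s; t; w0; par s; par t; par w0].
have [psA ptA] := (par_inner hubG sB, par_inner hubG tB).
have pwA := par_inner hubG wB.
have w0s : w0 != s by apply: contraNneq ws => ->.
have w0t : w0 != t by apply: contraNneq wt => ->.
split=> //=.
- rewrite !inE !negb_or ![c == _]eq_sym ![s == par _]eq_sym ![t == par _]eq_sym.
  rewrite [s == w0]eq_sym [t == w0]eq_sym ![par _ == par w0]eq_sym.
  rewrite (hub_s hubG) (hub_t hubG) (hub_st hubG) (outer_neq hubG wB).
  rewrite (inner_neq psA) (inner_neq ptA) (inner_neq pwA) w0s w0t ws wt pst.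
  rewrite ![w0 == par _]eq_sym.
  rewrite (inner_outer psA sB) (inner_outer psA tB) (inner_outer psA wB).
  rewrite (inner_outer ptA sB) (inner_outer ptA tB) (inner_outer ptA wB).
  by rewrite (inner_outer pwA sB) (inner_outer pwA tB) (inner_outer pwA wB).
- by rewrite !(par_par hubG) (par_hub hubG).
have defB : outer = [set w0; s; t].
  apply/esym/eqP; rewrite eqEcard b3 -setUA cardsU1 !inE negb_or w0s w0t.
  rewrite cards2 (hub_st hubG); apply/andP; split=> //.
  apply/subsetP => x.
  by rewrite !inE => /or3P[]/eqP->; [move: wB|move: sB|move: tB]; rewrite inE.
move=> x; apply: contraNeq => px.
have : x \in outer by rewrite inE.
by rewrite defB !inE -orbA => /or3P[]->; rewrite !orbT.
Qed.

End Cases.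

(** * All outer vertices in the two branches of the 5-cycle *)

(** Here p and q count the siblings of s and t, so that b = p + q + 2. The bound agrees with the
    target at p = q = 1; otherwise [p + q >= 3] yields a positive surplus. *)
Lemma full_count a p q e : 0 < a -> 0 < p -> 0 < q ->
  6 * a ^ 2 + 5 * a + 18 * a * (p + q + 2) + 22 * (p + q + 2)
    + 8 * (p + q) * (p + q + 2) + 3 * a * (p + q) + 16 * p * q
    <= e + 6 * a + 12 * (p + q + 2) + (p + q) + 30 ->
  6 * (1 + a + (p + q + 2)) ^ 2 + 17 * (1 + a + (p + q + 2)) <= e + 147 /\
  (p + q != 2 ->
   6 * (1 + a + (p + q + 2)) ^ 2 + 17 * (1 + a + (p + q + 2)) < e + 147).
Proof.
move=> a0 p0 q0; have pq : p + q <= p * q + 1.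
  by case: p q p0 q0 => // p [|q] // _ _; lia.
rewrite -[16 * p * q]mulnA; have : 2 <= p + q by lia.
move: (p * q) (p + q) pq => m s pq; rewrite leq_eqVlt => /predU1P[s2 | s3].
  rewrite -s2 in pq *; rewrite -!mulnn => bound; split=> //; lia.
have as3 : 3 * a <= a * s by rewrite mulnC leq_mul2l s3 orbT.
have s6 : 6 * s <= s * s + 9 by clear; have [|] := leqP s 3; nia.
by rewrite -!mulnn => bound; split=> [|_]; clear -a0 pq as3 s6 s3 bound; lia.
Qed.

Section Siblings.

Variables (G : sgraph) (c : G) (par : G -> G) (s t : G).
Hypotheses (connG : connected G) (hubG : hubbed c par s t).
Implicit Types (x y z u v w : G).

Local Notation inner := (inner c par).
Local Notation outer := (outer c par).
Local Notation a := #|inner|.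
Local Notation b := #|outer|.

Definition sibs x := [set w in outer | (par w == par x) && (w != x)].

Hypotheses (sB : s \in outer) (tB : t \in outer) (pst : par s != par t).

Lemma sibs_leaf w : w \in sibs s ->
  [/\ w \in outer, par w = par s, w != s & w != t].
Proof.
case/setIdP=> wB /andP[/eqP pw ws]; split=> //.
by apply: contraNneq pst => <-; rewrite pw.
Qed.

Lemma not_ends_inner x v : v \in inner -> ~~ ends s t x v.
Proof.
move=> vA; have [vs vt] := (inner_outer vA sB, inner_outer vA tB).
by rewrite /ends (negbTE vs) (negbTE vt) !andbF.
Qed.

Lemma dist_sibs_inner w v : w \in sibs s -> v \in inner -> v != par s ->
  2 < dist w v.
Proof.
move=> /sibs_leaf[wB pw ws wt] vA vps.
by apply: (dist_leaf_inner connG hubG) => //; rewrite ?pw // not_ends_inner.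
Qed.

Lemma dist_sibs_end w : w \in sibs s -> 2 < dist w t.
Proof.
move=> /sibs_leaf[wB pw ws wt]; apply: (dist_leaf connG hubG) => //.
rewrite pw dist_sym //; apply: (dist_outer_inner_gt1 connG hubG) => //.
  exact: (par_inner hubG sB).
exact: (not_ends_inner _ (par_inner hubG sB)).
Qed.

Lemma sibs_inner_sum w : w \in sibs s ->
  3 * a <= \sum_(v in inner) dist v w + 2.
Proof.
move=> wP; have [wB pw _ _] := sibs_leaf wP.
suff: \sum_(v in inner) 3 <= \sum_(v in inner) (dist v w + 2 * (v == par w)).
  rewrite !(sum_mulr_in, sum_add_in) sum_eq_in (par_inner hubG wB) muln1.
  by rewrite sum_nat_const mulnC.
apply: leq_sum => v vA; have [E|neq] := eqVneq v (par w).
  have : 0 < dist v w by rewrite dist_gt0 // (inner_outer vA wB).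
  by rewrite muln1 addn2 !ltnS.
by rewrite muln0 addn0 dist_sym // dist_sibs_inner // -pw.
Qed.

End Siblings.

Section SiblingRows.

Variables (G : sgraph) (c : G) (par : G -> G) (s t : G).
Hypotheses (connG : connected G) (hubG : hubbed c par s t).
Hypotheses (sB : s \in outer c par) (tB : t \in outer c par).
Hypothesis (pst : par s != par t).
Implicit Types (x y z u v w : G).

Local Notation inner := (inner c par).
Local Notation outer := (outer c par).
Local Notation a := #|inner|.
Local Notation b := #|outer|.
Local Notation P := (sibs c par s).
Local Notation Q := (sibs c par t).

Let pts : par t != par s. Proof. by rewrite eq_sym. Qed.

Lemma dist_sibs w u : w \in P -> u \in Q -> 3 < dist w u.
Proof.
move=> wP uQ; have [wB pw ws wt] := sibs_leaf pst wP.
have [uB pu ut us] := sibs_leaf pts uQ.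
apply: (dist_leaf connG hubG) => //.
  by apply: contraNneq pst => E; rewrite -pw E pu.
rewrite pw dist_sym //.
apply: (dist_sibs_inner connG (hubbed_sym hubG) tB sB pts uQ) => //.
exact: (par_inner hubG sB).
Qed.

(** The leaf [w] is at distance at least 3 from t, 4 from the siblings of t, and 2 from every other
    outer vertex but itself. *)
Lemma sibs_row w : w \in P ->
  2 * b + 1 + 2 * #|Q| <= \sum_(u in outer) dist u w + 2.
Proof.
move=> wP; have [wB pw ws wt] := sibs_leaf pst wP.
suff: \sum_(u in outer) (2 + (u == t) + 2 * (u \in Q))
      <= \sum_(u in outer) (dist u w + 2 * (u == w)).
  rewrite !(sum_mulr_in, sum_add_in) !sum_eq_in wB tB muln1 sum_nat_const mulnC.
  rewrite (sum_mem_in outer (mem Q)) /= (_ : [set x in outer | x \in Q] = Q) //.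
  by apply/setP => x; rewrite !inE; case: (par x != c).
apply: leq_sum => u uB; have [ut|ut] := eqVneq u t.
  rewrite ut inE !eqxx /= !andbF muln0 addn0.
  by rewrite (leq_trans _ (leq_addr _ _)) // dist_sym // (dist_sibs_end connG hubG).
have [uQ|uQ] := boolP (u \in Q).
  by rewrite (leq_trans _ (leq_addr _ _)) // dist_sym // dist_sibs.
rewrite muln0 !addn0; have [uw|uw] := eqVneq u w; first by rewrite leq_addl.
rewrite muln0 addn0; apply: dist_gt1 => //.
by rewrite (adj_outer hubG uB wB) /ends (negbTE ws) (negbTE wt) !andbF.
Qed.

(** The loss of 3 comes from s itself and its neighbour t; each sibling of t is at distance at least
    3. *)
Lemma end_row : 2 * b + #|Q| <= \sum_(u in outer) dist u s + 3.
Proof.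
suff: \sum_(u in outer) (2 + (u \in Q))
      <= \sum_(u in outer) (dist u s + 2 * (u == s) + (u == t)).
  rewrite !(sum_mulr_in, sum_add_in) !sum_eq_in sB tB muln1 sum_nat_const mulnC.
  rewrite (sum_mem_in outer (mem Q)) /= (_ : [set x in outer | x \in Q] = Q) //.
    by rewrite -addnA.
  by apply/setP => x; rewrite !inE; case: (par x != c).
apply: leq_sum => u uB; have [uQ|uQ] := boolP (u \in Q).
  rewrite -addnA (leq_trans _ (leq_addr _ _)) //.
  exact: (dist_sibs_end connG (hubbed_sym hubG) tB sB pts uQ).
apply: leq_trans (dist_ge2 connG u s) _; rewrite leq_add2l.
by rewrite (adj_outer hubG uB sB) /ends eqxx (negbTE (hub_st hubG)) andbF andbT.
Qed.

End SiblingRows.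

Section TwoBranches.

Variables (G : sgraph) (c : G) (par : G -> G) (s t : G).
Hypotheses (connG : connected G) (hubG : hubbed c par s t).
Hypotheses (sB : s \in outer c par) (tB : t \in outer c par).
Hypothesis (pst : par s != par t).
Hypothesis parB : forall w, w \in outer c par -> (par w == par s) || (par w == par t).
Implicit Types (x y z u v w : G).

Local Notation inner := (inner c par).
Local Notation outer := (outer c par).
Local Notation a := #|inner|.
Local Notation b := #|outer|.
Local Notation P := (sibs c par s).
Local Notation Q := (sibs c par t).

Let pts : par t != par s. Proof. by rewrite eq_sym. Qed.

Lemma sum_outer (F : G -> nat) : \sum_(w in outer) F w =
  F s + F t + \sum_(w in P) F w + \sum_(w in Q) F w.
Proof.
have nst := hub_st hubG.
rewrite (bigD1 s) //= (bigD1 t) /=; last by rewrite tB eq_sym.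
rewrite (bigID (fun w => par w == par s)) /= !addnA.
congr (_ + _ + _ + _); apply: eq_bigl => w; rewrite /sibs in_set.
  have [->|wt] := eqVneq w t; first by rewrite (negbTE pts) !andbF.
  by rewrite andbT -andbA [(w != s) && _]andbC.
have [->|ws] := eqVneq w s; first by rewrite (negbTE pst) !andbF.
have [->|wt] := eqVneq w t; first by rewrite !andbF.
rewrite !andbT; case: (boolP (w \in outer)) => //= /parB.
by have [->|] := eqVneq (par w) (par s); rewrite ?(negbTE pst).
Qed.

Lemma card_outer : b = #|P| + #|Q| + 2.
Proof. by rewrite -sum1_card sum_outer !sum1_card -addnA addnC. Qed.

(** Siblings of s and of t are at distance 4 from each other, but s and t are only guaranteed
    eccentricity 3. So outer vertices get weight 3, with 1 more on the siblings, whose rows are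
    estimated separately. The constant is 30 = 6 * 2 + 3 * (3 + 3), from the two shortened
    inner-outer pairs and the rows of s and t. *)
Lemma eds_full_ge : 0 < #|P| -> 0 < #|Q| ->
  6 * a ^ 2 + 5 * a + 18 * a * b + 22 * b + 8 * (#|P| + #|Q|) * b
    + 3 * a * (#|P| + #|Q|) + 16 * #|P| * #|Q|
    <= eds G + 6 * a + 12 * b + (#|P| + #|Q|) + 30.
Proof.
move=> /card_gt0P[w0 w0P] /card_gt0P[u0 u0Q].
have d4 := dist_sibs connG hubG sB tB pst.
have symG := hubbed_sym hubG.
have [w0B pw0 _ _] := sibs_leaf pst w0P; have [u0B pu0 _ _] := sibs_leaf pts u0Q.
have ecc_c : 2 <= ecc c by rewrite -(depth_outer hubG sB) -(dist_hub connG hubG) dist_ecc.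
have ecc_inner v : v \in inner -> 3 <= ecc v.
  move=> vA; have [E|neq] := eqVneq v (par s).
    apply: leq_trans (dist_ecc u0 v).
    by apply: (dist_sibs_inner connG symG tB sB pts u0Q) => //; rewrite E.
  by apply: leq_trans (dist_ecc w0 v); apply: (dist_sibs_inner connG hubG sB tB pst w0P).
have ecc_s : 3 <= ecc s.
  apply: leq_trans (dist_ecc u0 s).
  exact: (dist_sibs_end connG symG tB sB pts u0Q).
have ecc_t : 3 <= ecc t.
  apply: leq_trans (dist_ecc w0 t).
  exact: (dist_sibs_end connG hubG sB tB pst w0P).
have ecc_P w : w \in P -> 4 <= ecc w.
  by move=> wP; apply: leq_trans (dist_ecc u0 w); rewrite dist_sym // d4.
have ecc_Q u : u \in Q -> 4 <= ecc u.
  by move=> uQ; apply: leq_trans (dist_ecc w0 u); rewrite d4.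
have edsG : 2 * dist_sum c + 3 * (\sum_(v in inner) dist_sum v)
    + (3 * dist_sum s + 3 * dist_sum t + 4 * (\sum_(w in P) dist_sum w)
       + 4 * (\sum_(w in Q) dist_sum w)) <= eds G.
  rewrite /eds (sum_hub hubG) sum_outer -!sum_mulr_in.
  apply: leq_add; apply: leq_add; rewrite ?leq_mul2r ?ecc_c ?orbT //.
  - by apply: leq_sum => v vA; rewrite leq_mul2r ecc_inner ?orbT.
  - apply: leq_add.
      by apply: leq_add; rewrite leq_mul2r ?ecc_s ?ecc_t orbT.
    by apply: leq_sum => v vP; rewrite leq_mul2r ecc_P ?orbT.
  - by apply: leq_sum => v vQ; rewrite leq_mul2r ecc_Q ?orbT.
have Dout := dist_sum_outer connG hubG.
have Din := dist_sum_inner connG hubG.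
have Dc := dist_sum_hub connG hubG.
rewrite sum_outer in Dout.
have AA : 2 * a ^ 2 <= dAA c par + 2 * a + 0.
  apply: (dAA_ge connG); apply: leq_trans (sum_ends (@adj_inner _ _ _ _ _ hubG)) _.
  by case: (boolP (s \in inner)) => // /inner_outer/(_ sB); rewrite eqxx.
have AB : 3 * a * b <= dAB c par + 2 * b + 2.
  pose e v u : nat := (v == par t) * (u == s) + (v == par s) * (u == t).
  apply: (@dAB_ge _ _ _ _ _ hubG e); last exact: (sum_C5 hubG sB tB).
  by move=> v u; apply: (dist_outer_inner_C5 connG hubG).
have BB : dBB c par = \sum_(u in outer) dist u s + \sum_(u in outer) dist u t
   + \sum_(w in P) \sum_(u in outer) dist u w
   + \sum_(w in Q) \sum_(u in outer) dist u w by exact: sum_outer.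
have Rs := end_row connG hubG sB tB pst.
have Rt := end_row connG symG tB sB pts.
have RP : #|P| * (2 * b + 1 + 2 * #|Q|)
    <= \sum_(w in P) \sum_(u in outer) dist u w + #|P| * 2.
  rewrite -!sum_nat_const -sum_add_in; apply: leq_sum => w.
  exact: (sibs_row connG hubG sB tB pst).
have RQ : #|Q| * (2 * b + 1 + 2 * #|P|)
    <= \sum_(w in Q) \sum_(u in outer) dist u w + #|Q| * 2.
  rewrite -!sum_nat_const -sum_add_in; apply: leq_sum => w.
  exact: (sibs_row connG symG tB sB pts).
have CP : #|P| * (3 * a) <= \sum_(w in P) \sum_(v in inner) dist v w + #|P| * 2.
  rewrite -!sum_nat_const -sum_add_in; apply: leq_sum => w.
  exact: (sibs_inner_sum connG hubG sB tB pst).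
have CQ : #|Q| * (3 * a) <= \sum_(w in Q) \sum_(v in inner) dist v w + #|Q| * 2.
  rewrite -!sum_nat_const -sum_add_in; apply: leq_sum => w.
  exact: (sibs_inner_sum connG symG tB sB pts).
have DP (S : {set G}) : S \subset outer -> \sum_(w in S) dist_sum w = #|S| * 2
   + \sum_(w in S) \sum_(v in inner) dist v w + \sum_(w in S) \sum_(u in outer) dist u w.
  move=> /subsetP sub; rewrite -sum_nat_const -!sum_add_in; apply: eq_bigr => w /sub wB.
  by rewrite (hub_dist_sum connG hubG) (depth_outer hubG wB).
have subP x : sibs c par x \subset outer by apply/subsetP => w /setIdP[].
have DsP := DP _ (subP s); have DsQ := DP _ (subP t).
have cB := card_outer.
move: edsG Dout Din Dc AA AB BB Rs Rt RP RQ CP CQ DsP DsQ.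
clear.
move: (dist_sum c) (dist_sum s) (dist_sum t) (\sum_(v in inner) dist_sum v) (dAA c par)
  (dAB c par) (dBB c par) (\sum_(w in P) dist_sum w) (\sum_(w in Q) dist_sum w)
  (\sum_(u in outer) dist u s) (\sum_(u in outer) dist u t)
  (\sum_(w in P) \sum_(v in inner) dist v w)
  (\sum_(w in Q) \sum_(v in inner) dist v w)
  (\sum_(w in P) \sum_(u in outer) dist u w)
  (\sum_(w in Q) \sum_(u in outer) dist u w) (eds G) a b #|P| #|Q|.
move=> Dc Ds Dt DA AA AB BB DP DQ Rs Rt CP CQ RP RQ e a b p q.
lia.
Qed.

Lemma eds_C5_full : 3 < matching_number G ->
  eds_strict G \/
  (exists N, hub_shape C5_1_code c par N) /\ 6 * #|G| ^ 2 + 17 * #|G| <= eds G + 147.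
Proof.
move=> matchG.
(* If [x] had no siblings, then [c], [par y] and [x] would cover every edge. *)
have nonempty x y : x \in outer ->
    (forall w, w \in outer -> (par w == par x) || (par w == par y)) ->
    [|| s == par y, s == x, t == par y | t == x] -> 0 < #|sibs c par x|.
  move=> xB parxy st; rewrite lt0n; apply/eqP => /eqP; rewrite cards_eq0 => /eqP S0.
  have := matching_cover (x := par y) (y := x) hubG matchG.
  rewrite st => /(_ _)/negP[] // w wB.
  have /orP[pw|->] := parxy w wB; last by rewrite !orbT.
  have : w \notin sibs c par x by rewrite S0 inE.
  by rewrite inE wB pw /= negbK => ->; rewrite !orbT.
have P0 : 0 < #|P| by apply: (nonempty s t) => //; rewrite eqxx orbT.
have Q0 : 0 < #|Q|.
  apply: (nonempty t s) => //; last by rewrite eqxx !orbT.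
  by move=> w /parB; rewrite orbC.
have nG : #|G| = 1 + a + b := card_hub hubG.
have cB := card_outer.
have a0 : 0 < a by apply/card_gt0P; exists (par s); apply: (par_inner hubG).
have bound := eds_full_ge P0 Q0; rewrite cB in bound.
have [le_e lt_e] := full_count a0 P0 Q0 bound; rewrite -cB -nG in le_e lt_e.
have [E|/lt_e lt] := eqVneq (#|P| + #|Q|) 2; last by left; left.
right; split=> //.
have /cards1P[p defP] : #|P| == 1 by apply/eqP; lia.
have /cards1P[q defQ] : #|Q| == 1 by apply/eqP; lia.
have [pB pp ps pt] : [/\ p \in outer, par p = par s, p != s & p != t].
  by apply: (sibs_leaf pst); rewrite defP inE.
have [qB pq qt qs] : [/\ q \in outer, par q = par t, q != t & q != s].
  by apply: (sibs_leaf pts); rewrite defQ inE.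
exists [:: c; s; t; p; q; par s; par t].
have [psA ptA] := (par_inner hubG sB, par_inner hubG tB).
have npq : p != q by apply: contraNneq pst => E'; rewrite -pp E' pq.
split=> //=.
- rewrite !inE !negb_or ![c == _]eq_sym ![s == par _]eq_sym ![t == par _]eq_sym.
  rewrite [s == p]eq_sym [s == q]eq_sym [t == p]eq_sym [t == q]eq_sym.
  rewrite ![p == par _]eq_sym ![q == par _]eq_sym.
  rewrite (outer_neq hubG sB) (outer_neq hubG tB) (outer_neq hubG pB).
  rewrite (outer_neq hubG qB) (inner_neq psA) (inner_neq ptA) ps pt qs qt npq pst.
  rewrite (hub_st hubG).
  rewrite (inner_outer psA sB) (inner_outer psA tB) (inner_outer psA pB).
  rewrite (inner_outer psA qB) (inner_outer ptA sB) (inner_outer ptA tB).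
  by rewrite (inner_outer ptA pB) (inner_outer ptA qB).
- by rewrite pp pq !(par_par hubG) (par_hub hubG).
move=> x; apply: contraNeq => px.
have xB : x \in outer by rewrite inE.
have [->|xs] := eqVneq x s; first by rewrite !inE eqxx !orbT.
have [->|xt] := eqVneq x t; first by rewrite !inE eqxx !orbT.
have [pxs|pxt] := orP (parB xB).
  have : x \in P by rewrite inE xB pxs.
  by rewrite defP !inE => ->; rewrite !orbT.
have : x \in Q by rewrite inE xB pxt.
by rewrite defQ !inE => ->; rewrite !orbT.
Qed.

End TwoBranches.

(** * The extremal graphs *)

Lemma hubbed_connected (G : sgraph) (c : G) par s t :
  hubbed c par s t -> connected G.
Proof.
move=> hubG; have to_c x : connect (@adj G) x c.
  have step y : connect (@adj G) y (par y).
    have [->|yc] := eqVneq y c; first by rewrite (par_hub hubG).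
    by apply: connect1; apply: (adj_par hubG).
  by apply: connect_trans (step x) _; rewrite -(par_par hubG x).
move=> x y; apply: connect_trans (to_c x) _.
by rewrite (sym_connect_sym (@adj_sym G)).
Qed.

(* Copies of U4, U4' and C5_1 attached at explicit ordinals: [inord] does not
   compute, whereas here adjacency is decided by reduction on constructors. *)
Section Models.

Variable k : nat.

Local Notation o3 i := (@Ordinal 3 i isT).
Local Notation o5 i := (@Ordinal 5 i isT).
Local Notation o2 i := (@Ordinal 2 i isT).
Local Notation o1 := (@Ordinal 1 0 isT).

Definition U4_model : sgraph :=
  let G1 := @pendants (cycle_graph 0) (o3 0) k in
  let G2 := pendant_path (inl (o3 0) : G1) 2 in
  pendant_path (inl (inl (o3 0)) : G2) 2.

Definition U4_par (x : U4_model) : U4_model :=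
  match x with
  | inl (inr (Ordinal 1 _)) => inl (inr (o2 0))
  | inr (Ordinal 1 _) => inr (o2 0)
  | _ => inl (inl (inl (o3 0)))
  end.

Lemma U4_shape : hub_shape U4_code (inl (inl (inl (o3 0))) : U4_model) U4_par
  [:: inl (inl (inl (o3 0))); inl (inl (inl (o3 1))); inl (inl (inl (o3 2)));
      inl (inr (o2 1)); inr (o2 1); inl (inr (o2 0)); inr (o2 0)].
Proof.
split=> //; last first.
  by case=> [[[[[|[|[|i]]] iP]|i]|[[|[|i]] iP]]|[[|[|i]] iP]].
split=> //.
  by case=> [[[[[|[|[|i]]] iP]|i]|[[|[|i]] iP]]|[[|[|i]] iP]].
case=> [[[[[|[|[|i]]] iP]|i]|[[|[|i]] iP]]|[[|[|i]] iP]] //;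
  by case=> [[[[[|[|[|j]]] jP]|j]|[[|[|j]] jP]]|[[|[|j]] jP]].
Qed.

Definition U4'_model : sgraph :=
  let G1 := @pendants (cycle_graph 2) (o5 1) k in
  pendant_path (inl (o5 1) : G1) 2.

Definition U4'_par (x : U4'_model) : U4'_model :=
  match x with
  | inl (inl (Ordinal 3 _)) => inl (inl (o5 2))
  | inl (inl (Ordinal 4 _)) => inl (inl (o5 0))
  | inr (Ordinal 1 _) => inr (o2 0)
  | _ => inl (inl (o5 1))
  end.

(** The hub is [u_2], and the edge of the 5-cycle outside the tree is the opposite one, between
    [u_4] and [u_5]; the same holds in [C5_shape]. *)
Lemma U4'_shape : hub_shape U4'_code (inl (inl (o5 1)) : U4'_model) U4'_par
  [:: inl (inl (o5 1)); inl (inl (o5 3)); inl (inl (o5 4)); inr (o2 1);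
      inl (inl (o5 2)); inl (inl (o5 0)); inr (o2 0)].
Proof.
split=> //; last first.
  by case=> [[[[|[|[|[|[|i]]]]] iP]|i]|[[|[|i]] iP]].
split=> //.
  by case=> [[[[|[|[|[|[|i]]]]] iP]|i]|[[|[|i]] iP]].
case=> [[[[|[|[|[|[|i]]]]] iP]|i]|[[|[|i]] iP]] //;
  by case=> [[[[|[|[|[|[|j]]]]] jP]|j]|[[|[|j]] jP]].
Qed.

Definition C5_model : sgraph :=
  let G1 := @pendants (cycle_graph 2) (o5 0) 1 in
  let G2 := pendants (inl (o5 1) : G1) k in
  pendants (inl (inl (o5 2)) : G2) 1.

Definition C5_par (x : C5_model) : C5_model :=
  match x with
  | inl (inl (inl (Ordinal 3 _))) => inl (inl (inl (o5 2)))
  | inl (inl (inl (Ordinal 4 _))) => inl (inl (inl (o5 0)))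
  | inl (inl (inr _)) => inl (inl (inl (o5 0)))
  | inr _ => inl (inl (inl (o5 2)))
  | _ => inl (inl (inl (o5 1)))
  end.

Lemma C5_shape : hub_shape C5_1_code (inl (inl (inl (o5 1))) : C5_model) C5_par
  [:: inl (inl (inl (o5 1))); inl (inl (inl (o5 3))); inl (inl (inl (o5 4)));
      inr o1; inl (inl (inr o1)); inl (inl (inl (o5 2))); inl (inl (inl (o5 0)))].
Proof.
split=> //; last first.
  by case=> [[[[[|[|[|[|[|i]]]]] iP]|[[|i] iP]]|i]|[[|i] iP]].
split=> //.
  by case=> [[[[[|[|[|[|[|i]]]]] iP]|[[|i] iP]]|i]|[[|i] iP]].
case=> [[[[[|[|[|[|[|i]]]]] iP]|[[|i] iP]]|i]|[[|i] iP]] //;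
  by case=> [[[[[|[|[|[|[|j]]]]] jP]|[[|j] jP]]|j]|[[|j] jP]].
Qed.

Lemma card_U4_model : #|U4_model| = k + 7.
Proof. by rewrite !card_sum !card_ord; lia. Qed.

Lemma card_U4'_model : #|U4'_model| = k + 7.
Proof. by rewrite !card_sum !card_ord; lia. Qed.

Lemma card_C5_model : #|C5_model| = k + 7.
Proof. by rewrite !card_sum !card_ord; lia. Qed.

End Models.

Lemma U4_modelE n : U4 n = U4_model (n - 7).
Proof.
rewrite /U4 /U4_model; have -> // : (inord 0 : 'I_3) = @Ordinal 3 0 isT.
by apply/val_inj; rewrite /= inordK.
Qed.

Lemma C5uE i (lt_i : i < 5) : C5u i = Ordinal lt_i.
Proof. by apply/val_inj; rewrite /C5u /= inordK. Qed.

Lemma U4'_modelE n : U4' n = U4'_model (n - 7).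
Proof. by rewrite /U4' /U4'_model (C5uE (i := 1) isT). Qed.

Lemma C5_modelE k : C5_1 1 k 1 = C5_model k.
Proof.
rewrite /C5_1 /C5_model (C5uE (i := 0) isT) (C5uE (i := 1) isT).
by rewrite (C5uE (i := 2) isT).
Qed.

(** * Upper bounds showing that the extremal values are attained *)

Lemma sum_seq (T : finType) (S : {set T}) (r : seq T) (F : T -> nat) :
  uniq r -> (forall x, (x \in S) = (x \in r)) ->
  \sum_(x in S) F x = \sum_(x <- r) F x.
Proof. by move=> ur memS; rewrite big_uniq //=; apply: eq_bigl. Qed.

Section UpperBounds.

Variables (G : sgraph) (c : G) (par : G -> G) (s t : G).
Hypotheses (connG : connected G) (hubG : hubbed c par s t).
Implicit Types (x y z u v w : G).

Local Notation inner := (inner c par).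
Local Notation outer := (outer c par).
Local Notation a := #|inner|.
Local Notation b := #|outer|.

Lemma dAA_le : dAA c par + 2 * a <= 2 * a ^ 2.
Proof.
suff: \sum_(v in inner) \sum_(u in inner) (dist u v + 2 * (u == v))
   <= \sum_(v in inner) \sum_(u in inner) 2.
  rewrite !sum_nat_const (eq_bigr (fun v => (\sum_(u in inner) dist u v) + 2)).
    by rewrite sum_add_in sum_nat_const -/(dAA c par); lia.
  by move=> v vA; rewrite !(sum_mulr_in, sum_add_in) sum_eq_in vA.
apply: leq_sum => v vA; apply: leq_sum => u uA.
have [->|uv] := eqVneq u v; first by rewrite distxx.
rewrite muln0 addn0; apply: leq_trans (dist_hub_le connG hubG u v) _.
by rewrite (depth_inner uA) (depth_inner vA).
Qed.

Lemma dist_cross_end : dist s (par t) <= 2.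
Proof.
apply: leq_trans (dist_adj connG _ (adj_st hubG)) _.
by rewrite dist_adj1 // (adj_par hubG) // (hub_t hubG).
Qed.

Lemma ecc_outer_le w : w \in outer -> ecc w <= 4.
Proof.
move=> wB; apply/ecc_leP => u; apply: leq_trans (dist_hub_le connG hubG u w) _.
by rewrite (depth_outer hubG wB) /depth; case: (u != c); case: (par u != c).
Qed.

Lemma ecc_inner_le v : v \in inner -> ecc v <= 3.
Proof.
move=> vA; apply/ecc_leP => u; apply: leq_trans (dist_hub_le connG hubG u v) _.
by rewrite (depth_inner vA) /depth; case: (u != c); case: (par u != c).
Qed.

Lemma ecc_hub_le : ecc c <= 2.
Proof.
apply/ecc_leP => u; rewrite (dist_hub connG hubG) /depth.
by case: (u != c); case: (par u != c).
Qed.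

Lemma dist_inner_outer_le v w : v \in inner -> w \in outer -> dist w v <= 3.
Proof. by move=> vA wB; apply: leq_trans (dist_ecc w v) (ecc_inner_le vA). Qed.

Lemma dist_outer_le v w : w \in outer -> dist v w <= 4.
Proof. by move=> wB; apply: leq_trans (dist_ecc v w) (ecc_outer_le wB). Qed.

Lemma dist_par_le w : w \in outer -> dist w (par w) <= 1.
Proof. by move=> wB; rewrite dist_adj1 // (adj_par hubG) // (outer_neq hubG wB). Qed.

End UpperBounds.

Section CycleUpperBound.

Variables (G : sgraph) (c : G) (par : G -> G) (s t : G).
Hypotheses (connG : connected G) (hubG : hubbed c par s t).
Hypotheses (sB : s \in outer c par) (tB : t \in outer c par).
Hypothesis (pst : par s != par t).
Implicit Types (x y z u v w : G).

Local Notation inner := (inner c par).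
Local Notation outer := (outer c par).
Local Notation a := #|inner|.
Local Notation b := #|outer|.

(** The estimate of [dAB_ge] with the 5-cycle defect [e] is an equality: distances through the tree
    are at most 3, and the two crossing pairs are joined along the extra edge. *)
Lemma dAB_le : dAB c par + 2 * b + 2 <= 3 * a * b.
Proof.
pose e v w : nat := (v == par t) * (w == s) + (v == par s) * (w == t).
have sum_e : \sum_(v in inner) \sum_(w in outer) e v w = 2.
  rewrite (eq_bigr (fun v => (v == par t) + (v == par s))) => [|v vA].
    by rewrite sum_add_in !sum_eq_in !(par_inner hubG).
  by rewrite !(sum_mulr_in, sum_add_in) !sum_eq_in sB tB !muln1.
suff: \sum_(v in inner) \sum_(w in outer) (dist w v + 2 * (v == par w) + e v w)
   <= \sum_(v in inner) \sum_(w in outer) 3.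
  have parE : \sum_(v in inner) \sum_(w in outer) (v == par w) = b.
    rewrite exchange_big /= -sum1_card; apply: eq_bigr => w wB.
    by rewrite sum_eq_in (par_inner hubG).
  rewrite !sum_nat_const.
  rewrite (eq_bigr (fun v => (\sum_(w in outer) dist w v)
     + 2 * (\sum_(w in outer) (v == par w)) + \sum_(w in outer) e v w)).
    rewrite !(sum_mulr_in, sum_add_in) parE sum_e -/(dAB c par).
    by rewrite [b * 3]mulnC mulnCA mulnA.
  by move=> v vA; rewrite !(sum_mulr_in, sum_add_in).
apply: leq_sum => v vA; apply: leq_sum => w wB; rewrite /e.
have d3 := dist_inner_outer_le connG hubG vA wB.
have [E|neq] := eqVneq v (par w).
  have -> : (v == par t) * (w == s) + (v == par s) * (w == t) = 0.
    rewrite E; have [->|_] := eqVneq w s; last rewrite muln0.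
      by rewrite (negbTE (hub_st hubG)) (negbTE pst) muln0.
    by have [->|_] := eqVneq w t; rewrite ?muln0 // eq_sym (negbTE pst).
  by rewrite addn0 E; apply: leq_add (dist_par_le connG hubG wB) _.
rewrite muln0 addn0; have [ws|ws] := eqVneq w s.
  rewrite ws (negbTE (hub_st hubG)) muln0 addn0 muln1 -ws.
  have [vt|vt] := eqVneq v (par t); last by rewrite addn0.
  by rewrite addn1 ltnS ws vt; apply: dist_cross_end connG hubG.
rewrite muln0 add0n; have [wt|wt] := eqVneq w t; last by rewrite muln0 addn0.
have [vs|vs] := eqVneq v (par s); last by rewrite addn0.
by rewrite addn1 ltnS wt vs; apply: dist_cross_end connG (hubbed_sym hubG).
Qed.

End CycleUpperBound.

Lemma eds_le_U4' (G : sgraph) c par (N : seq G) :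
  hub_shape U4'_code c par N -> eds G + 100 <= 6 * #|G| ^ 2 + 14 * #|G|.
Proof.
case=> hubG uN Nc parN rest; have sN : size N = 7.
  by rewrite -(size_map par) parN.
case: N sN hubG uN Nc parN rest => [|x [|s [|t [|w [|ps [|pt [|pw []]]]]]]] //= _.
move=> hubG uN xc; rewrite {x}xc in hubG uN *.
case=> _ Es Et Ew _ _ _ rest; have connG := hubbed_connected hubG.
have pst : par s != par t.
  by move: uN; rewrite Es Et /= !inE !negb_or => /and5P[_ _ _ _ /and3P[/andP[]]].
have pc y : y \in [:: ps; pt; pw] -> y != c.
  move=> yl; move: uN => /andP[+ _]; apply: contraNneq => <-.
  by move: yl; rewrite !inE => /or3P[]->; rewrite !orbT.
have defB y : (y \in outer c par) = (y \in [:: s; t; w]).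
  apply/idP/idP; last first.
    by rewrite !inE => /or3P[]/eqP->; rewrite ?Es ?Et ?Ew pc // !inE eqxx ?orbT.
  rewrite [y \in outer _ _]inE;
  have [|/rest->] := boolP (y \in [:: c; s; t; w; ps; pt; pw]);
    last by rewrite eqxx.
  have E z : z \in [:: c; ps; pt; pw] -> par z = c.
    have E0 := par_hub hubG; rewrite !inE => /or4P[]/eqP-> //;
    by rewrite -?Es -?Et -?Ew (par_par hubG).
  move=> yN; apply: contraNT => yB; apply/eqP/E.
  move: yB; rewrite !inE !negb_or => /and3P[/negbTE Ns /negbTE Nt /negbTE Nw].
  by move: yN; rewrite !inE Ns Nt Nw.
have u3 : uniq [:: s; t; w].
  by move: uN; rewrite /= !inE !negb_or => /and5P[_ /and4P[-> -> _ _] /andP[-> _] _ _].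
have [sB tB wB] : [/\ s \in outer c par, t \in outer c par & w \in outer c par].
  by rewrite !defB !inE !eqxx !orbT.
have cB : #|outer c par| = 3 by rewrite (eq_card defB) (card_uniqP u3).
(* 18 = 2 * (1 + 4 + 4), for the pairs s-t, s-w and t-w. *)
have BB : dBB c par <= 18.
  rewrite /dBB (sum_seq _ u3 defB) !big_cons big_nil !(sum_seq _ u3 defB).
  rewrite !big_cons !big_nil !distxx !addn0 !add0n.
  rewrite (dist_adj1 connG (adj_st hubG)).
  rewrite (dist_adj1 connG (adj_st (hubbed_sym hubG))).
  have := dist_outer_le connG hubG s wB; have := dist_outer_le connG hubG t wB.
  by rewrite !(dist_sym connG w); clear; lia.
have AA := dAA_le connG hubG.
have AB := dAB_le connG hubG sB tB pst.
have edsG : eds G <= 2 * dist_sum c + 3 * (\sum_(v in inner c par) dist_sum v)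
    + 4 * (\sum_(v in outer c par) dist_sum v).
  rewrite /eds (sum_hub hubG) -!sum_mulr_in; apply: leq_add; first apply: leq_add.
  - by rewrite leq_mul2r (ecc_hub_le connG hubG) orbT.
  - by apply: leq_sum => v vA; rewrite leq_mul2r (ecc_inner_le connG hubG) ?orbT.
  - by apply: leq_sum => v vB; rewrite leq_mul2r (ecc_outer_le connG hubG) ?orbT.
rewrite (dist_sum_hub connG hubG) (dist_sum_inner connG hubG) in edsG.
rewrite (dist_sum_outer connG hubG) cB in edsG; rewrite cB in AB.
rewrite (card_hub hubG) cB; move: AA AB BB edsG; clear.
move: (dAA c par) (dAB c par) (dBB c par) (eds G) #|_| => AA AB BB e a.
rewrite -!mulnn; lia.
Qed.

Lemma eds_le_C5 (G : sgraph) c par (N : seq G) :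
  hub_shape C5_1_code c par N -> eds G + 147 <= 6 * #|G| ^ 2 + 17 * #|G|.
Proof.
case=> hubG uN Nc parN rest; have sN : size N = 7.
  by rewrite -(size_map par) parN.
case: N sN hubG uN Nc parN rest => [|x [|s [|t [|p [|q [|ps [|pt []]]]]]]] //= _.
move=> hubG uN xc; rewrite {x}xc in hubG uN *.
case=> _ Es Et Ep Eq _ _ rest; have connG := hubbed_connected hubG.
have pst : par s != par t.
  by move: uN; rewrite Es Et /= !inE !negb_or => /and5P[_ _ _ _ /and3P[_ + _]].
have pc y : y \in [:: ps; pt] -> y != c.
  move=> yl; move: uN => /andP[+ _]; apply: contraNneq => <-.
  by move: yl; rewrite !inE => /orP[]->; rewrite !orbT.
have defB y : (y \in outer c par) = (y \in [:: s; t; p; q]).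
  apply/idP/idP; last first.
    by rewrite !inE => /or4P[]/eqP->; rewrite ?Es ?Et ?Ep ?Eq pc // !inE eqxx ?orbT.
  rewrite [y \in outer _ _]inE;
  have [|/rest->] := boolP (y \in [:: c; s; t; p; q; ps; pt]);
    last by rewrite eqxx.
  have E z : z \in [:: c; ps; pt] -> par z = c.
    have E0 := par_hub hubG; rewrite !inE => /or3P[]/eqP-> //;
    by rewrite -?Es -?Et (par_par hubG).
  move=> yN; apply: contraNT => yB; apply/eqP/E.
  move: yB; rewrite !inE !negb_or.
  move=> /and4P[/negbTE Ns /negbTE Nt /negbTE Np /negbTE Nq].
  by move: yN; rewrite !inE Ns Nt Np Nq.
have u4 : uniq [:: s; t; p; q].
  by move: uN; rewrite /= !inE !negb_or
    => /and5P[_ /and5P[-> -> -> _ _] /and4P[-> -> _ _] /andP[-> _] _].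
have [sB tB pB qB] : [/\ s \in outer c par, t \in outer c par, p \in outer c par
    & q \in outer c par] by rewrite !defB !inE !eqxx !orbT.
have symG := hubbed_sym hubG.
have cB : #|outer c par| = 4 by rewrite (eq_card defB) (card_uniqP u4).
have dst := dist_adj1 connG (adj_st hubG).
have dpq : dist p q <= 4 := dist_outer_le connG hubG p qB.
have dps : dist p s <= 2.
  apply: leq_trans (dist_triangle connG p ps s) _; rewrite -{1}Ep -Es.
  by rewrite (dist_sym connG (par s)) (leq_add (n1 := 1) (n2 := 1)) //
       (dist_par_le connG hubG).
have dqt : dist q t <= 2.
  apply: leq_trans (dist_triangle connG q pt t) _; rewrite -{1}Eq -Et.
  by rewrite (dist_sym connG (par t)) (leq_add (n1 := 1) (n2 := 1)) //
       (dist_par_le connG hubG).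
have dpt : dist p t <= 3.
  by have := dist_triangle connG p s t; rewrite dst; move: dps; clear; lia.
have dqs : dist q s <= 3.
  have := dist_triangle connG q t s; rewrite (dist_sym connG t) dst.
  by move: dqt; clear; lia.
have row_p : \sum_(u in outer c par) dist u p <= 9.
  rewrite (sum_seq _ u4 defB) !big_cons big_nil distxx.
  rewrite !(dist_sym connG _ p); move: dps dpt dpq; clear; lia.
have row_q : \sum_(u in outer c par) dist u q <= 9.
  rewrite (sum_seq _ u4 defB) !big_cons big_nil distxx.
  rewrite !(dist_sym connG _ q) (dist_sym connG q p); move: dqs dqt dpq; clear; lia.
(* 30 = 2 * (1 + 2 + 2 + 3 + 3 + 4), for the pairs st, ps, qt, pt, qs and pq. *)
have BB : dBB c par <= 30.
  rewrite /dBB (sum_seq _ u4 defB) !big_cons big_nil.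
  move: row_p row_q; rewrite !(sum_seq _ u4 defB) !big_cons !big_nil !distxx.
  rewrite (dist_sym connG t s) dst (dist_sym connG s p) (dist_sym connG s q).
  rewrite (dist_sym connG t p) (dist_sym connG t q).
  by move: dps dqt dpt dqs; clear; lia.
have colA y : y \in outer c par ->
    \sum_(v in inner c par) dist v y + 2 <= 3 * #|inner c par|.
  move=> yB; suff: \sum_(v in inner c par) (dist v y + 2 * (v == par y))
      <= \sum_(v in inner c par) 3.
    rewrite !(sum_mulr_in, sum_add_in) sum_eq_in (par_inner hubG yB) muln1.
    by rewrite sum_nat_const mulnC.
  apply: leq_sum => v vA; rewrite dist_sym //; have [->|_] := eqVneq v (par y).
    by apply: leq_add (dist_par_le connG hubG yB) _.
  by rewrite addn0 (dist_inner_outer_le connG hubG).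
have ecc_s : ecc s <= 3.
  apply/ecc_leP => u; case: (hub_cases c par u) => [->|uA|].
  - by rewrite dist_sym // (dist_hub connG hubG) (depth_outer hubG sB).
  - by rewrite dist_sym // (dist_inner_outer_le connG hubG).
  rewrite defB !inE => /or4P[]/eqP->; rewrite ?distxx //.
  + by rewrite dist_sym // dst.
  + exact: leq_trans dps _.
have ecc_t : ecc t <= 3.
  apply/ecc_leP => u; case: (hub_cases c par u) => [->|uA|].
  - by rewrite dist_sym // (dist_hub connG hubG) (depth_outer hubG tB).
  - by rewrite dist_sym // (dist_inner_outer_le connG hubG).
  rewrite defB !inE => /or4P[]/eqP->; rewrite ?distxx //.
  + by rewrite dst.
  + exact: leq_trans dqt _.
have AA := dAA_le connG hubG.
have AB := dAB_le connG hubG sB tB pst.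
(* The weights of [eds_full_ge] again: 3 on all outer vertices and 1 more on the leaves [p] and
   [q]. *)
have edsG : eds G <= 2 * dist_sum c + 3 * (\sum_(v in inner c par) dist_sum v)
    + (3 * (\sum_(v in outer c par) dist_sum v) + (dist_sum p + dist_sum q)).
  rewrite /eds (sum_hub hubG) -!sum_mulr_in; apply: leq_add; first apply: leq_add.
  - by rewrite leq_mul2r (ecc_hub_le connG hubG) orbT.
  - by apply: leq_sum => v vA; rewrite leq_mul2r (ecc_inner_le connG hubG) ?orbT.
  rewrite !(sum_seq _ u4 defB) !big_cons !big_nil.
  have Hs : ecc s * dist_sum s <= 3 * dist_sum s by rewrite leq_mul2r ecc_s orbT.
  have Ht : ecc t * dist_sum t <= 3 * dist_sum t by rewrite leq_mul2r ecc_t orbT.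
  have Hp : ecc p * dist_sum p <= 4 * dist_sum p.
    by rewrite leq_mul2r (ecc_outer_le connG hubG) ?orbT.
  have Hq : ecc q * dist_sum q <= 4 * dist_sum q.
    by rewrite leq_mul2r (ecc_outer_le connG hubG) ?orbT.
  by move: Hs Ht Hp Hq; clear; lia.
rewrite (dist_sum_hub connG hubG) (dist_sum_inner connG hubG) in edsG.
rewrite (dist_sum_outer connG hubG) cB in edsG; rewrite cB in AB.
rewrite (hub_dist_sum connG hubG p) (hub_dist_sum connG hubG q) in edsG.
rewrite (depth_outer hubG pB) (depth_outer hubG qB) in edsG.
have := colA p pB; have := colA q qB.
rewrite (card_hub hubG) cB; move: AA AB BB row_p row_q edsG; clear.
move: (dAA c par) (dAB c par) (dBB c par) (eds G) => AA AB BB e.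
move: (\sum_(u in outer _ _) dist u p) (\sum_(u in outer _ _) dist u q).
move: (\sum_(u in inner _ _) dist u p) (\sum_(u in inner _ _) dist u q).
move: #|_| => a; rewrite -!mulnn; lia.
Qed.

(** * The theorem *)

Lemma eds_cases (G : sgraph) : 8 < #|G| -> unicyclic G -> 3 < matching_number G ->
  [\/ eds_strict G,
      exists c par N, @hub_shape U4_code G c par N,
      (exists c par N, @hub_shape U4'_code G c par N)
        /\ 6 * #|G| ^ 2 + 14 * #|G| <= eds G + 100 |
      (exists c par N, @hub_shape C5_1_code G c par N)
        /\ 6 * #|G| ^ 2 + 17 * #|G| <= eds G + 147].
Proof.
move=> G_gt8 uniG matchG; have connG := uniG.1.
have [c ecc_c|ecc3] := pickP (fun c : G => ecc c <= 2); last first.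
  constructor 1; left; apply: eds_radius3 => // v.
  by rewrite ltnNge ecc3.
have [par [s [t hubG]]] := hubbed_exists uniG ecc_c.
have symG := hubbed_sym hubG.
have place x : x != c -> (x \in inner c par) || (x \in outer c par).
  by case: (hub_cases c par x) => [->|->|->]; rewrite ?eqxx ?orbT.
have /orP[sA|sB] := place s (hub_s hubG); have /orP[tA|tB] := place t (hub_t hubG).
- have [|[N shN]] := eds_inner_inner connG hubG matchG sA tA.
    by constructor 1.
  by constructor 2; exists c, par, N.
- by constructor 1; apply: (eds_inner_outer connG hubG).
- by constructor 1; apply: (eds_inner_outer connG symG).
have [pst|pst] := eqVneq (par s) (par t).
  by constructor 1; apply: (eds_siblings connG hubG).
have [w /and3P[wB ws wt]|none] := pickP (fun w => [&& w \in outer c par,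
    par w != par s & par w != par t]).
  have [|[[N shN] le_e]] := eds_C5_branch connG hubG sB tB pst wB ws wt.
    by constructor 1.
  by constructor 3; split=> //; exists c, par, N.
have parB w : w \in outer c par -> (par w == par s) || (par w == par t).
  by move=> wB; have := none w; rewrite wB /=; case: eqP => //=; case: eqP.
have [|[[N shN] le_e]] := eds_C5_full connG hubG sB tB pst parB matchG.
  by constructor 1.
by constructor 4; split=> //; exists c, par, N.
Qed.

Theorem theorem3p6 (n : nat) (G : sgraph) :
  9 <= n -> in_U n 4 G -> ~ iso G (U4 n) ->
  (n <= 15 ->
     6 * n ^ 2 + 17 * n - 147 <= eds G /\
     (eds G = 6 * n ^ 2 + 17 * n - 147 <-> iso G (C5_1 1 (n - 7) 1))) /\
  (16 <= n ->
     6 * n ^ 2 + 14 * n - 100 <= eds G /\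
     (eds G = 6 * n ^ 2 + 14 * n - 100 <-> iso G (U4' n))).
Proof.
move=> n_ge9 [cardG uniG matchG]; rewrite U4_modelE U4'_modelE C5_modelE => NU4.
have nk : n = n - 7 + 7 by rewrite subnK // (leq_trans _ n_ge9).
(* This makes the truncated subtractions of the statement exact. *)
have n_sq : 9 * n <= n ^ 2 by rewrite -mulnn leq_mul2r n_ge9 orbT.
have C5_le : iso G (C5_model (n - 7)) -> eds G + 147 <= 6 * n ^ 2 + 17 * n.
  move/eds_iso->; have := eds_le_C5 (C5_shape (n - 7)).
  by rewrite card_C5_model -nk.
have U4'_le : iso G (U4'_model (n - 7)) -> eds G + 100 <= 6 * n ^ 2 + 14 * n.
  move/eds_iso->; have := eds_le_U4' (U4'_shape (n - 7)).
  by rewrite card_U4'_model -nk.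
have := eds_cases; move/(_ G); rewrite /eds_strict cardG matchG.
case=> // [strict|[c [par [N shN]]]|[[c [par [N shN]]] ge_e]|[[c [par [N shN]]] ge_e]].
- split=> [n_le15|n_ge16]; split; try split.
  + by case: strict; lia.
  + by case: strict; lia.
  + by move/C5_le; case: strict; lia.
  + by case: strict; lia.
  + by case: strict; lia.
  + by move/U4'_le; case: strict; lia.
- case: NU4; apply: shape_iso shN (U4_shape (n - 7)) _.
  by rewrite card_U4_model -nk.
- have isoG : iso G (U4'_model (n - 7)).
    by apply: shape_iso shN (U4'_shape (n - 7)) _; rewrite card_U4'_model -nk.
  (* For n <= 15 the value at [U4'] is strictly above the first bound, since 3n <= 45 < 47; for n >=
     16 the roles are exchanged, since 3n >= 48. *)
  have := U4'_le isoG; split=> [n_le15|n_ge16]; split; try split=> //; try lia.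
  by move/C5_le; lia.
- have isoG : iso G (C5_model (n - 7)).
    by apply: shape_iso shN (C5_shape (n - 7)) _; rewrite card_C5_model -nk.
  have := C5_le isoG; split=> [n_le15|n_ge16]; split; try split=> //; try lia.
  by move/U4'_le; lia.
Qed.
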